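(* Consider the degree-correlated stochastic block model (DCSBM) with $n$ nodes and $k\ge2$ communities $C_1^*,\dots,C_k^*$ as in the context, with random adjacency matrix $A$ and degree vector $d$. Let $\Phi^*\in\{0,1\}^{n\times k}$ be the true assignment matrix, let $1\le p\le k$ and let $\lambda$ be the tuning parameter, let $U^*\in\mathbb{R}^{n\times k}$ be a global optimal solution of the relaxation $$\min_{U\in\mathbb{R}^{n\times k}}\ \langle -(A-\lambda dd^{\top}),UU^{\top}\rangle\quad\text{s.t.}\quad \|u_i\|^2=1,\ \|u_i\|_0\le p,\ i=1,\dots,n,\quad U\ge 0,$$ and let $\Delta=U^*(U^* )^{\top}-\Phi^*(\Phi^* )^{\top}$. Suppose that $\bar\Phi\in\mathcal{A}^{n\times k}$ (together with some $\bar X_c\in\mathbb{R}^{k\times k}$) is the output of a K-means approximation algorithm with $k$ clusters and approximation ratio $\alpha(k)$ applied to the rows of $U^*$. Then $$\min_{\Pi}|Err_{\Pi}(\bar\Phi)|\le\frac{8\sqrt{k}\,n_{\max}}{\theta_{\min}n_{\min}}\left(1+\frac{n_{\max}}{n_{\min}}\right)(1+\alpha(k))\,\|\Delta\|_{1,\theta}^{1/2},$$ where the minimum is over all $k\times k$ permutation matrices $\Pi$. Here $\|\Delta\|_{1,\theta}$ is bounded with high probability as follows: there is an absolute constant $C_0>0$ such that, if the density gap condition $\max_{1\le a<b\le k}\frac{B_{ab}}{H_aH_b}<\min_{1\le a\le k}\frac{B_{aa}}{H_a^2}$ holds and, for some $\delta>0$, $\max_{1\le a<b\le k}\frac{B_{ab}+\delta}{H_aH_b}<\lambda<\min_{1\le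 a\le k}\frac{B_{aa}-\delta}{H_a^2}$, then with probability at least $0.99-2(e/2)^{-2n}$, $$\|\Delta\|_{1,\theta}\le\frac{C_0}{\delta}\left(1+\left(\max_{1\le a\le k}\frac{B_{aa}}{H_a^2}\|f\|_1\right)\right)\left(\sqrt{n\|f\|_1}+n\right).$$
   Context: DCSBM: $C_1^*,\dots,C_k^*$ is a partition of $[n]=\{1,\dots,n\}$ into nonempty sets, $B\in\mathbb{R}^{k\times k}$ is symmetric with entries in $[0,1]$, and $\theta=(\theta_1,\dots,\theta_n)$ has positive entries with all $B_{ab}\theta_i\theta_j\le1$. The adjacency matrix $A\in\{0,1\}^{n\times n}$ is random, symmetric, $A_{ii}=0$, and for $i\in C_a^*$, $j\in C_b^*$, $i\neq j$, $A_{ij}=1$ with probability $B_{ab}\theta_i\theta_j$ and $A_{ij}=0$ otherwise, independently over unordered pairs $\{i,j\}$. The degree vector is $d_i=\sum_jA_{ij}$. Notation: $n_a=|C_a^*|$, $n_{\max}=\max_an_a$, $n_{\min}=\min_an_a$, $\theta_{\min}=\min_i\theta_i$, $G_a=\sum_{i\in C_a^*}\theta_i$, $H_a=\sum_{b=1}^kB_{ab}G_b$ (assumed positive), $f_i=H_a\theta_i$ for $i\in C_a^*$, $\|f\|_1=\sum_i|f_i|$, $\|X\|_{1,\theta}=\sum_{i,j}|X_{ij}|\theta_i\theta_j$. For $U\in\mathbb{R}^{n\times k}$, $u_i^{\top}$ denotes its $i$th row; $\|u\|_0$ is the number of nonzero entries; $\|\cdot\|$ is the Euclidean norm; $\langle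 X,Y\rangle=\mathrm{Tr}(X^{\top}Y)$. $\mathcal{A}^{n\times k}$ is the set of assignment matrices: $n\times k$ matrices with entries in $\{0,1\}$ and exactly one $1$ in each row. The true assignment matrix $\Phi^*\in\mathcal{A}^{n\times k}$ has $\Phi^*_{ia}=1$ iff $i\in C_a^*$; its $i$th row is denoted $\phi_i^*$. For a permutation matrix $\Pi$, $Err_\Pi(\bar\Phi)=\{i:(\bar\Phi\Pi)_i\ne\phi_i^*\}$, where $(\cdot)_i$ denotes the $i$th row. K-means problem: minimize $\|\Phi X_c-U^*\|_F^2$ over $\Phi\in\mathcal{A}^{n\times k}$, $X_c\in\mathbb{R}^{k\times k}$. A K-means algorithm has approximation ratio $\alpha(k)$ if its output $(\bar\Phi,\bar X_c)$ is feasible and $\|\bar\Phi\bar X_c-U^*\|_F^2$ is at most $\alpha(k)$ times the optimal value. *)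

(* Defs.v *)
From HB Require Import structures.
From mathcomp Require Import all_boot all_order all_algebra.
From mathcomp Require Import perm.
From mathcomp Require Import all_classical all_reals all_analysis.
Set Implicit Arguments.
Unset Strict Implicit.
Unset Printing Implicit Defensive.
Import Order.TTheory GRing.Theory Num.Theory.
Import numFieldNormedType.Exports.
Local Open Scope classical_set_scope.
Local Open Scope ring_scope.

(* The partition of the nodes into k nonempty indexed communities is encoded
   by its label function: node i lies in the community [label M i].  The
   product bound [prob_le1] ranges over all i and j, including i = j. *)
Record dcsbm_model (R : realType) (n k : nat) := DCSBM {
  label : 'I_n -> 'I_k;
  conn : 'M[R]_k;
  theta : 'I_n -> R;
  label_surj : forall a, exists i, label i = a;
  conn_sym : conn^T = conn;
  conn01 : forall a b, 0 <= conn a b <= 1;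
  theta_gt0 : forall i, 0 < theta i;
  prob_le1 : forall i j, conn (label i) (label j) * theta i * theta j <= 1
}.

Section Model.
Variables (R : realType) (n k : nat) (M : dcsbm_model R n k).

Definition community (a : 'I_k) : {set 'I_n} := [set i | label M i == a]%SET.

Definition n_max : nat := \max_(a < k) #|community a|.

(* The initial value n of the iterated minimum is harmless: it bounds the size
   of every community. *)
Definition n_min : nat := \big[minn/n]_(a < k) #|community a|.

Definition theta_min : R := inf (range (theta M)).

Definition G_ (a : 'I_k) : R := \sum_(i in community a) theta M i.

Definition H_ (a : 'I_k) : R := \sum_b conn M a b * G_ b.

Definition f_ (i : 'I_n) : R := H_ (label M i) * theta M i.

Definition f_norm1 : R := \sum_i `|f_ i|.

Definition norm1theta (X : 'M[R]_n) : R :=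
  \sum_i \sum_j `|X i j| * theta M i * theta M j.

Definition Phi_star : 'M[R]_(n, k) := \matrix_(i, a) (label M i == a)%:R.

(* The suprema and infima below are over finite sets, nonempty for k >= 2,
   so that they are maxima and minima. *)
Definition max_offdiag (eps : R) : R :=
  sup [set (conn M ab.1 ab.2 + eps) / (H_ ab.1 * H_ ab.2) |
       ab in [set ab : 'I_k * 'I_k | (ab.1 < ab.2)%N]].

Definition min_diag (eps : R) : R :=
  inf (range (fun a => (conn M a a - eps) / H_ a ^+ 2)).

Definition max_diag_f : R :=
  sup (range (fun a => conn M a a / H_ a ^+ 2 * f_norm1)).

Definition density_gap : Prop := max_offdiag 0 < min_diag 0.

Definition Err (s : 'S_k) (Phi : 'M[R]_(n, k)) : {set 'I_n} :=
  [set i | row i (Phi *m perm_mx s) != row i Phi_star]%SET.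

(* Again n bounds the cardinal of every [Err s Phi]. *)
Definition min_err (Phi : 'M[R]_(n, k)) : nat :=
  \big[minn/n]_(s : 'S_k) #|Err s Phi|.

End Model.

(* The product rule over all subfamilies of the X i, i in D, and over all their
   possible values. *)
Definition mutual_indep d (T : measurableType d) (R : realType)
    (P : probability T R) (I : finType) (D : {set I}) (X : I -> T -> bool) :=
  forall (S : {set I}) (v : I -> bool), S \subset D ->
    P [set w | forall i, i \in S -> X i w = v i] =
    (\prod_(i in S) P [set w | X i w = v i])%E.

Record is_dcsbm d (T : measurableType d) (R : realType) (P : probability T R)
    (n k : nat) (M : dcsbm_model R n k)
    (A : 'I_n -> 'I_n -> {RV P >-> bool}) : Prop := {
  adj_sym : forall i j w, A i j w = A j i w;
  adj_irr : forall i w, A i i w = false;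
  adj_prob : forall i j, i != j ->
    P [set w | A i j w = true] =
    (conn M (label M i) (label M j) * theta M i * theta M j)%:E;
  adj_indep : mutual_indep P [set ij : 'I_n * 'I_n | (ij.1 < ij.2)%N]%SET
    (fun ij w => A ij.1 ij.2 w)
}.

Definition adj d (T : measurableType d) (R : realType) (P : probability T R)
    (n : nat) (A : 'I_n -> 'I_n -> {RV P >-> bool}) (w : T) : 'M[R]_n :=
  \matrix_(i, j) (A i j w)%:R.

Section Optimization.
Variables (R : realType) (n k : nat).
Implicit Types (A : 'M[R]_n) (U Phi : 'M[R]_(n, k)) (X : 'M[R]_k).

Definition degree A : 'cV[R]_n := \col_i \sum_j A i j.

Definition inner (m p : nat) (X Y : 'M[R]_(m, p)) : R := \tr (X^T *m Y).

Definition relax_obj (lambda : R) A U : R :=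
  inner (- (A - lambda *: (degree A *m (degree A)^T))) (U *m U^T).

Definition relax_feasible (p : nat) U : Prop :=
  [/\ forall i, \sum_j U i j ^+ 2 = 1,
      forall i, (#|[set j | U i j != 0%R]%SET| <= p)%N
    & forall i j, 0 <= U i j].

Definition relax_opt (p : nat) (lambda : R) A U : Prop :=
  relax_feasible p U /\
  forall V, relax_feasible p V -> relax_obj lambda A U <= relax_obj lambda A V.

Definition is_assignment Phi : Prop :=
  (forall i j, Phi i j = 0 \/ Phi i j = 1) /\
  (forall i, #|[set j | Phi i j == 1%R]%SET| = 1%N).

Definition kmeans_obj U Phi X : R := \sum_i \sum_j (Phi *m X - U) i j ^+ 2.

Definition kmeans_opt U : R :=
  inf [set kmeans_obj U PX.1 PX.2 |
       PX in [set PX : 'M[R]_(n, k) * 'M[R]_k | is_assignment PX.1]].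

Definition kmeans_approx (alpha : R) U Phi X : Prop :=
  is_assignment Phi /\ kmeans_obj U Phi X <= alpha * kmeans_opt U.

End Optimization.

(* Main.v *)
Require Import Defs.
From HB Require Import structures.
From mathcomp Require Import all_boot all_order all_algebra.
From mathcomp Require Import perm.
From mathcomp Require Import all_classical all_reals all_analysis.
From mathcomp Require Import ring lra.
Set Implicit Arguments.
Unset Strict Implicit.
Unset Printing Implicit Defensive.
Import Order.TTheory GRing.Theory Num.Theory.
Import numFieldNormedType.Exports.

(** Why the theorem holds.

    Misclassification.  Since the rows of U are nonnegative unit vectors, an
    entry of Delta is [<u_i,u_j> - 1] inside a community and [<u_i,u_j>] across
    two communities, so the unweighted norm [L] of Delta (at most the weighted
    one divided by [theta_min ^ 2]) decomposes over pairs of communities.  In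
    terms of the means [x_a] of the rows of each community, block [(a, a)]
    weighs [n_a ^ 2 * (1 - |x_a|^2)] and block [(a, b)] weighs
    [n_a * n_b * <x_a, x_b>].  The diagonal part bounds the cost of the true
    clustering by [L / n_min], hence also, up to the factor [1 + alpha], the
    distance from the means [x_a] to the centers that K-means returns: few nodes
    are far from the mean of their community.  All weights being nonnegative,
    at most [4 * L / n_min ^ 2] communities are bad, and the means of two other
    communities are at distance at least 1.  So two nodes that are not far, of
    distinct communities that are not bad, are never put in the same cluster
    ([far_bad_separated]); [cluster_matching] turns this into a permutation and
    counts the errors.  The count is quadratic in [sqrt L / n_min]; it is below
    the claimed bound, which is linear in [sqrt L / n_min], unless the latter is
    at least [k * n_max >= n], where there is nothing to prove.  The factor
    [sqrt k] comes from balancing these cases ([min_err_bound]).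

    Size of Delta.  Let [E] be the matrix of edge probabilities (diagonal
    included); its row sums are the [f_i].  By optimality of U against the true
    assignment matrix, [<A - lambda d d^T, Delta> >= 0], while the two gap
    conditions on lambda say that [<E - lambda f f^T, Delta>] is at most
    [- delta * |Delta|], entry by entry.  Subtracting, [delta * |Delta|] is at
    most [<A - E, Delta> - lambda * <d d^T - f f^T, Delta>] ([gap_bound]).  The
    first term is a difference of two values of the noise [A - E] on Gram
    matrices of unit vectors, which the inequality of Grothendieck
    ([grothendieck]) bounds by a constant times the maximum of the noise over
    pairs of sign vectors.  The second one is controlled by [|d - f|_1], itself
    at most this maximum plus [n], times the total degree.

    Probability.  The edges have an explicit finite product law.  An exponential
    moment and a union bound over the [4 ^ n] pairs of sign vectors bound the
    noise by [12 * (sqrt (n * |f|_1) + n)] up to probability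
    [4 ^ n * exp (- 2 * n)], that is [(e / 2) ^ (- 2 * n)]; by the Markov
    inequality the total degree exceeds [100 * |f|_1] with probability at most
    [0.01] ([irregular_law]). *)

Local Open Scope ring_scope.

(** * Grothendieck's inequality *)

Fixpoint cube (m : nat) : finType :=
  if m is m'.+1 then (bool * cube m')%type : finType else unit.

(** The sum of the [a l], [l < m], with independent uniform signs.  The discrete
    cube is an iterated product so that its moments follow by induction on
    [m], splitting on the first sign. *)
Fixpoint rademacher (R : pzRingType) (a : nat -> R) (m : nat) : cube m -> R :=
  if m is m'.+1 then fun w => (-1) ^+ w.1 * a m' + rademacher a w.2
  else fun=> 0.

Lemma sum_cubeS (R : nmodType) (m : nat) (F : cube m.+1 -> R) :
  \sum_w F w = \sum_(w : cube m) (F (true, w) + F (false, w)).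
Proof.
rewrite (eq_bigr (fun w => F (w.1, w.2))); last by case.
rewrite -(pair_bigA _ (fun b w => F (b, w))) exchange_big.
by apply: eq_bigr => w _; rewrite big_bool.
Qed.

Lemma card_cube (m : nat) : #|cube m| = (2 ^ m)%N.
Proof.
by elim: m => [|j IHj] /=; rewrite ?card_unit // card_prod card_bool IHj expnS.
Qed.

(** Random signs are orthonormal, so [rademacher] embeds the coordinate space
    isometrically into the functions on the cube. *)
Lemma rademacher_inner (R : comPzRingType) (a b : nat -> R) (m : nat) :
  \sum_(w : cube m) rademacher a w * rademacher b w =
  2 ^+ m * \sum_(l < m) a l * b l.
Proof.
elim: m => [|m IHm]; first by rewrite big1 ?big_ord0 ?mulr0 // => w _; rewrite mul0r.
rewrite sum_cubeS big_ord_recr /= [2 ^+ _]exprS -mulrA [2 ^+ m * _]mulrDr -IHm mulrDr.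
have -> : 2 ^+ m * (a m * b m) = \sum_(w : cube m) a m * b m.
  by rewrite sumr_const card_cube -[RHS]mulr_natl natrX.
rewrite !mulr_sumr -big_split /=.
by apply: eq_bigr => w _; rewrite expr1 expr0; ring.
Qed.

(** Makes the truncation of a random sum cheap in L2.  Adding an independent term
    of size [a] to a sum with second moment [s] turns a fourth moment [q] into
    [a^4 + 6 * a^2 * s + q], which stays below [3 * (s + a^2)^2]. *)
Lemma rademacher_moment4 (R : realFieldType) (a : nat -> R) (m : nat) :
  \sum_(w : cube m) rademacher a w ^+ 4 <=
  3 * 2 ^+ m * (\sum_(l < m) a l ^+ 2) ^+ 2.
Proof.
elim: m => [|m IHm]; first by rewrite big1 ?big_ord0 ?expr0n ?mulr0 // => w _; rewrite expr0n.
have H2 := rademacher_inner a a m.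
have -> : \sum_(w : cube m.+1) rademacher a w ^+ 4 =
    2 * (2 ^+ m * a m ^+ 4) + 12 * a m ^+ 2 * (2 ^+ m * \sum_(l < m) a l * a l)
    + 2 * \sum_(w : cube m) rademacher a w ^+ 4.
  have -> : 2 ^+ m * a m ^+ 4 = \sum_(w : cube m) a m ^+ 4.
    rewrite sumr_const.
    by rewrite card_cube -[RHS]mulr_natl natrX.
  rewrite sum_cubeS -H2 !mulr_sumr -!big_split /=.
  by apply: eq_bigr => w _; rewrite expr1 expr0; ring.
rewrite big_ord_recr /= [2 ^+ m.+1]exprS.
have -> : \sum_(l < m) a l * a l = \sum_(l < m) a l ^+ 2.
  by apply: eq_bigr => l _; rewrite expr2.
set s := \sum_(l < m) _ in IHm *.
have : 0 <= 2 ^+ m * a m ^+ 4 by apply: mulr_ge0; [exact: exprn_ge0 | exact: exprn_even_ge0].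
nra.
Qed.

(** Vectors indexed by a finite type, read as sequences through its enumeration,
    which is the form [rademacher] takes. *)
Definition coord (R : nmodType) (I : finType) (u : I -> R) (l : nat) : R :=
  nth 0 (map u (enum I)) l.

Lemma sum_coord (R : nmodType) (I : finType) (u v : I -> R) (f : R -> R -> R) :
  \sum_(l < #|I|) f (coord u l) (coord v l) = \sum_l f (u l) (v l).
Proof.
rewrite (reindex (@enum_val I I)) /=; last first.
  by apply: onW_bij; exact: enum_val_bij.
apply: eq_bigr => l _.
have coordE (a : I -> R) : coord a l = a (enum_val l).
  rewrite /coord (nth_map (enum_val l)) -?cardE //.
  by rewrite -(enum_val_nth (enum_val l)).
by rewrite !coordE.
Qed.

Section Grothendieck.
Variables (R : realType) (m n : nat) (W : 'M[R]_(m, n)).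

Definition sign_bound (t : R) : Prop := forall (x : {ffun 'I_m -> bool})
  (y : {ffun 'I_n -> bool}),
  \sum_i \sum_j W i j * ((-1) ^+ x i * (-1) ^+ y j) <= t.

Lemma sign_bound_abs (t : R) (y : {ffun 'I_n -> bool}) : sign_bound t ->
  \sum_i `|\sum_j W i j * (-1) ^+ y j| <= t.
Proof.
move=> /(_ [ffun i => \sum_j W i j * (-1) ^+ y j < 0] y); apply: le_trans.
apply: ler_sum => i _; rewrite normrEsign ?num_real // mulr_sumr; apply: ler_sum => j _.
by rewrite ffunE mulrCA.
Qed.

Lemma ler_mul_abs (x y : R) : `|y| <= 1 -> x * y <= `|x|.
Proof.
move=> hy; rewrite (le_trans (ler_norm _)) // normrM ler_piMr //.
Qed.

(** A bilinear form is maximal on a product of boxes at the vertices: first the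
    coordinates of [y], then those of [x], can be replaced with signs. *)
Lemma sign_bound_box (t : R) (x : 'I_m -> R) (y : 'I_n -> R) : sign_bound t ->
  (forall i, `|x i| <= 1) -> (forall j, `|y j| <= 1) ->
  \sum_i \sum_j W i j * (x i * y j) <= t.
Proof.
move=> ht hx hy.
pose z := [ffun j => \sum_i W i j * x i < 0].
apply: le_trans (sign_bound_abs z ht).
apply: (@le_trans _ _ (\sum_j `|\sum_i W i j * x i|)).
  rewrite exchange_big /=; apply: ler_sum => j _.
  rewrite (eq_bigr (fun i => W i j * x i * y j)); last by move=> i _; rewrite mulrA.
  by rewrite -mulr_suml ler_mul_abs.
apply: (@le_trans _ _ (\sum_i (\sum_j W i j * (-1) ^+ z j) * x i)).
  under [leRHS]eq_bigr do rewrite mulr_suml.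
  rewrite exchange_big /=; apply: ler_sum => j _.
  rewrite normrEsign ?num_real // mulr_sumr; apply: ler_sum => i _.
  by rewrite ffunE [leLHS]mulrCA mulrA.
by apply: ler_sum => i _; exact: ler_mul_abs.
Qed.

(** The bound quantifies over all finite index types because improving the
    constant replaces the vectors with functions on a much larger cube. *)
Definition gram_bound (K : R) : Prop := forall (I : finType)
  (u : 'I_m -> I -> R) (v : 'I_n -> I -> R),
  (forall i, \sum_l u i l ^+ 2 <= 1) -> (forall j, \sum_l v j l ^+ 2 <= 1) ->
  \sum_i \sum_j W i j * (\sum_l u i l * v j l) <= K.

Lemma gram_bound_trivial : gram_bound (\sum_i \sum_j `|W i j|).
Proof.
move=> I u v hu hv; apply: ler_sum => i _; apply: ler_sum => j _.
apply: ler_mul_abs; apply: (@le_trans _ _ (\sum_l (u i l ^+ 2 + v j l ^+ 2) / 2)).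
  apply: le_trans (ler_norm_sum _ _ _) _; apply: ler_sum => l _.
  rewrite normrM -(real_normK (num_real (u i l))) -(real_normK (num_real (v j l))).
  have := sqr_ge0 (`|u i l| - `|v j l|); nra.
rewrite -mulr_suml big_split /=; have := hu i; have := hv j; nra.
Qed.

Definition trunc (x : R) : R := if `|x| <= 7 then x else 0.

Lemma trunc_le (x : R) : `|trunc x / 7| <= 1.
Proof.
rewrite /trunc; case: ifP => h; rewrite ?mul0r ?normr0 //.
rewrite normrM [`|7^-1|]ger0_norm //; lra.
Qed.

Lemma trunc_sqr_le (x : R) : trunc x ^+ 2 <= x ^+ 2.
Proof. by rewrite /trunc; case: ifP => h //; rewrite expr0n /= sqr_ge0. Qed.

Lemma trunc_tail (x : R) : 49 * (x - trunc x) ^+ 2 <= x ^+ 4.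
Proof.
rewrite /trunc; case: ifP => [_|/negbT]; first by rewrite subrr expr0n /= mulr0 exprn_even_ge0.
rewrite -ltNge subr0 => h.
have h2 : 49 <= x ^+ 2 by rewrite -(real_normK (num_real x)); nra.
rewrite [x ^+ 4](_ : _ = x ^+ 2 * x ^+ 2); last by ring.
by rewrite ler_wpM2r ?sqr_ge0.
Qed.

(** Embed the vectors as random sums and truncate these at 7.  The truncated
    parts are bounded, so the form on them is at most [49 * t] pointwise.  The
    tails have L2 norm at most 1/4, because [49 * (x - trunc x)^2 <= x^4] and
    the fourth moment is at most 3, so the two remaining terms are at most
    [K / 4] each by the bound one starts from. *)
Lemma gram_bound_improve (t K : R) : sign_bound t -> gram_bound K ->
  gram_bound (49 * t + K / 2).
Proof.
move=> ht hK I u v hu hv.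
(* Multiplying functions by [c] turns the counting measure of the cube into the
   uniform probability. *)
pose c : R := Num.sqrt (2 ^- #|I|).
have c2K : c * c * 2 ^+ #|I| = 1.
  have p2 : 0 < 2 ^+ #|I| :> R by apply: exprn_gt0.
  by rewrite -expr2 sqr_sqrtr ?invr_ge0 ?(ltW p2) // mulVf // gt_eqF.
pose x i (w : cube #|I|) := rademacher (coord (u i)) w.
pose y j (w : cube #|I|) := rademacher (coord (v j)) w.
have unit_emb (a : I -> R) : \sum_l a l ^+ 2 <= 1 ->
    \sum_(w : cube #|I|) (c * rademacher (coord a) w) ^+ 2 <= 1.
  move=> ha; under eq_bigr do rewrite expr2 mulrACA.
  by rewrite -mulr_sumr rademacher_inner mulrA c2K mul1r (sum_coord _ _ (fun p q => p * q)).
(* The factor 4 rescales the tails, of norm at most 1/4, to unit vectors. *)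
have small_tail (a : I -> R) : \sum_l a l ^+ 2 <= 1 ->
    \sum_(w : cube #|I|)
      (4 * (c * (rademacher (coord a) w - trunc (rademacher (coord a) w)))) ^+ 2 <= 1.
  move=> ha; set T := \sum_w _.
  have hT : 49 * T <= 16 * (c * c) * \sum_(w : cube #|I|) rademacher (coord a) w ^+ 4.
    rewrite !mulr_sumr; apply: ler_sum => w _.
    have := trunc_tail (rademacher (coord a) w).
    set X := rademacher _ _; have : 0 <= c * c by rewrite -expr2 sqr_ge0.
    by move=> h1 h2; have := ler_wpM2l h1 h2; nra.
  have := rademacher_moment4 (coord a) #|I|.
  have -> : \sum_(l < #|I|) coord a l ^+ 2 = \sum_l a l ^+ 2.
    by rewrite -(sum_coord a a (fun p q => p ^+ 2)).
  move: ha; set s := \sum_l a l ^+ 2; set Q := \sum_w _ in hT * => ha hQ.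
  have s0 : 0 <= s by apply: sumr_ge0 => l _; exact: sqr_ge0.
  have c20 : 0 <= c * c by rewrite -expr2 sqr_ge0.
  have : c * c * Q <= 3 * s ^+ 2.
    apply: le_trans (ler_wpM2l c20 hQ) _.
    have -> : c * c * (3 * 2 ^+ #|I| * s ^+ 2) = c * c * 2 ^+ #|I| * (3 * s ^+ 2).
      by ring.
    by rewrite c2K mul1r.
  have : s ^+ 2 <= 1 by rewrite expr_le1.
  lra.
have tail_le (U : 'I_m -> cube #|I| -> R) (V : 'I_n -> cube #|I| -> R) :=
  hK (cube #|I|) U V.
have -> : \sum_i \sum_j W i j * (\sum_l u i l * v j l) =
    \sum_w c * c * (\sum_i \sum_j W i j * (trunc (x i w) * trunc (y j w)))
  + 4^-1 * (\sum_i \sum_j W i j *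
      \sum_w (4 * (c * (x i w - trunc (x i w)))) * (c * y j w))
  + 4^-1 * (\sum_i \sum_j W i j *
      \sum_w (c * trunc (x i w)) * (4 * (c * (y j w - trunc (y j w))))).
  have -> : \sum_w c * c * (\sum_i \sum_j W i j * (trunc (x i w) * trunc (y j w))) =
     \sum_i \sum_j W i j * \sum_w c * c * (trunc (x i w) * trunc (y j w)).
    under eq_bigr do rewrite mulr_sumr.
    rewrite exchange_big /=; apply: eq_bigr => i _.
    under eq_bigr do rewrite mulr_sumr.
    rewrite exchange_big /=; apply: eq_bigr => j _.
    by rewrite mulr_sumr; apply: eq_bigr => w _; ring.
  rewrite !mulr_sumr -!big_split; apply: eq_bigr => i _ /=.
  rewrite !mulr_sumr -!big_split; apply: eq_bigr => j _ /=.
  have -> : \sum_l u i l * v j l = \sum_w c * c * (x i w * y j w).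
    by rewrite -mulr_sumr rademacher_inner mulrA c2K mul1r (sum_coord _ _ (fun p q => p * q)).
  rewrite !mulr_sumr -!big_split; apply: eq_bigr => w _ /=.
  by field.
rewrite -addrA; apply: lerD.
  rewrite [leRHS](_ : _ = \sum_(w : cube #|I|) c * c * (49 * t)); last first.
    by rewrite sumr_const card_cube -[RHS]mulr_natl natrX mulrA [2 ^+ _ * _]mulrC c2K mul1r.
  apply: ler_sum => w _; rewrite ler_wpM2l ?mulr_ge0 ?sqrtr_ge0 //.
  have := sign_bound_box ht (fun i => trunc_le (x i w)) (fun j => trunc_le (y j w)).
  rewrite [X in X <= t -> _](_ : _ = 49^-1 *
    \sum_i \sum_j W i j * (trunc (x i w) * trunc (y j w))).
    lra.
  rewrite mulr_sumr; apply: eq_bigr => i _; rewrite mulr_sumr.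
  by apply: eq_bigr => j _; field.
have trunc_unit (a : I -> R) : \sum_l a l ^+ 2 <= 1 ->
    \sum_(w : cube #|I|) (c * trunc (rademacher (coord a) w)) ^+ 2 <= 1.
  move=> ha; apply: le_trans (unit_emb a ha); apply: ler_sum => w _.
  by rewrite !exprMn ler_wpM2l ?sqr_ge0 ?trunc_sqr_le.
have h1 := tail_le (fun i w => 4 * (c * (x i w - trunc (x i w))))
  (fun j w => c * y j w) (fun i => small_tail _ (hu i)) (fun j => unit_emb _ (hv j)).
have h2 := tail_le (fun i w => c * trunc (x i w))
  (fun j w => 4 * (c * (y j w - trunc (y j w))))
  (fun i => trunc_unit _ (hu i)) (fun j => small_tail _ (hv j)).
lra.
Qed.

(** Iterating the improvement from the trivial bound converges geometrically to
    the fixed point [98 * t] of [K |-> 49 * t + K / 2]. *)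
Theorem grothendieck (t : R) : sign_bound t -> gram_bound (98 * t).
Proof.
move=> ht; pose L : R := \sum_i \sum_j `|W i j|.
have step N : gram_bound (98 * t + (2^-1) ^+ N * (L - 98 * t)).
  elim: N => [|N IHN].
    by rewrite expr0 mul1r addrC subrK; exact: gram_bound_trivial.
  have := gram_bound_improve ht IHN.
  by congr gram_bound; rewrite exprS; field.
move=> I u v hu hv; apply/ler_addgt0Pr => e e0.
have [N hN] : exists N, (2^-1) ^+ N * (L - 98 * t) <= e.
  pose N := Num.truncn (`|L - 98 * t| / e).
  exists N.+1; have h2 : (2 : R) ^+ N.+1 > 0 by rewrite exprn_gt0.
  rewrite exprVn mulrC ler_pdivrMr //.
  apply: le_trans (ler_norm _) _; rewrite [leRHS]mulrC -ler_pdivrMr //.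
  apply: ltW; apply: lt_trans (truncnS_gt _) _.
  by rewrite -natrX ltr_nat ltn_expl.
by apply: le_trans (step N I u v hu hv) _; rewrite lerD2l.
Qed.

End Grothendieck.

(** * Clusters, permutations and label errors *)

(** A partial injection of a finite type extends to a permutation: the
    complements of its domain and of its image have the same size, and are
    matched along their enumerations. *)
Lemma perm_extends (T : finType) (A : {set T}) (g : T -> T) :
  {in A &, injective g} -> exists s : {perm T}, {in A, forall x, s x = g x}.
Proof.
move=> gI.
have cAB : #|~: A| = #|~: (g @: A)|.
  by rewrite [LHS]cardsCs [RHS]cardsCs !finset.setCK card_in_imset.
(* The default of [nth] never matters: the index is in range by [hidx]. *)
pose h x := nth x (enum (~: (g @: A))) (index x (enum (~: A))).
have hidx x : x \notin A -> (index x (enum (~: A)) < size (enum (~: (g @: A))))%N.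
  by move=> xA; rewrite -cardE -cAB cardE index_mem mem_enum inE.
have hB x : x \notin A -> h x \notin g @: A.
  move=> /hidx/(mem_nth x); rewrite -/(h x) mem_enum inE => h1; exact: h1.
have hI x y : x \notin A -> y \notin A -> h x = h y -> x = y.
  move=> xA yA; rewrite /h (set_nth_default y) ?hidx // => /eqP.
  rewrite nth_uniq ?hidx ?enum_uniq // => /eqP e.
  have xin : x \in enum (~: A) by rewrite mem_enum inE.
  have yin : y \in enum (~: A) by rewrite mem_enum inE.
  by rewrite -(nth_index x xin) e nth_index.
pose f x := if x \in A then g x else h x.
have fI : injective f.
  move=> x y; rewrite /f; case: ifPn => xA; case: ifPn => yA; last exact: hI.
  - exact: gI.
  - by move=> e; have := hB y yA; rewrite -e imset_f.
  - by move=> e; have := hB x xA; rewrite e imset_f.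
by exists (perm fI) => x xA; rewrite permE /f xA.
Qed.

Lemma card_bigcup_le (I T : finType) (P : {set I}) (F : I -> {set T}) (m : nat) :
  (forall i, i \in P -> (#|F i| <= m)%N) ->
  (#|\bigcup_(i in P) F i| <= m * #|P|)%N.
Proof.
move=> hF; rewrite mulnC -sum_nat_const.
elim/big_rec2: _ => [|i b A iP h]; first by rewrite cards0.
by rewrite (leq_trans (finset.leq_card_setU _ _)) // leq_add // hF.
Qed.

(** [S] is the set of nodes about which nothing is known and [B] the set of
    communities about which nothing is known.  Call a community good if it is
    not in [B] and has a node outside [S]; the cluster of such a node is its
    own, and the permutation sends it to the community.  A node that is still in
    error is in [S], or in one of the other communities, or outside [S] in a
    cluster that belongs to no good community.  By separation, the nodes of the
    third kind in a given cluster lie in a single community, and there are as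
    many unclaimed clusters as communities that are not good; hence the
    factor 2. *)
Lemma cluster_matching (n k m : nat) (l c : 'I_n -> 'I_k) (S : {set 'I_n})
    (B : {set 'I_k}) :
  (forall a, (#|[set i | l i == a]| <= m)%N) ->
  (forall i j, i \notin S -> j \notin S -> l i \notin B -> l j \notin B ->
    c i = c j -> l i = l j) ->
  exists s : 'S_k, (#|[set i | s (c i) != l i]| <=
    #|S| + 2 * (m * (#|B| + #|[set a | [set i | l i == a] \subset S]|)))%N.
Proof.
move=> hm sep; pose F a := [set i | l i == a].
pose D := [set a | F a \subset S]; pose T := ~: (B :|: D).
have repP a : a \in T -> exists i, (l i == a) && (i \notin S).
  rewrite !inE negb_or => /andP[_ /subsetPn[i]]; rewrite inE => ia iS.
  by exists i; rewrite ia iS.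
have TB a : a \in T -> a \notin B by rewrite !inE negb_or => /andP[].
pose g a := if [pick i | (l i == a) && (i \notin S)] is Some i then c i else a.
have gP a : a \in T -> exists i, [/\ l i = a, i \notin S & g a = c i].
  move=> /repP[i0 hi0]; rewrite /g; case: pickP => [i /andP[/eqP ia iS]|/(_ i0)].
    by exists i.
  by rewrite hi0.
have gI : {in T &, injective g}.
  move=> a b aT bT; have [i [ia iS ->]] := gP a aT; have [j [jb jS ->]] := gP b bT.
  by rewrite -ia -jb; apply: sep => //; rewrite ?ia ?jb TB.
have [s sE] := perm_extends gI; exists (s^-1)%g.
pose Q := ~: (g @: T).
have cQ : #|Q| = #|B :|: D| by rewrite [LHS]cardsCs finset.setCK card_in_imset // [RHS]cardsCs.
pose S2 := \bigcup_(a in B :|: D) F a.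
pose S3 := \bigcup_(q in Q) [set i | [&& i \notin S, l i \in T & c i == q]].
have sub : [set i | (s^-1)%g (c i) != l i] \subset S :|: S2 :|: S3.
  apply/fintype.subsetP => i; rewrite inE => bad; rewrite !finset.in_setU.
  have [//|iS] := boolP (i \in S) => /=.
  have [lB|lB] := boolP (l i \in B :|: D).
    by apply/orP; left; apply/finset.bigcupP; exists (l i) => //; rewrite inE.
  have lT : l i \in T by rewrite inE.
  apply/orP; right; apply/finset.bigcupP; exists (c i); last by rewrite inE iS lT eqxx.
  rewrite inE; apply: contra bad => /imsetP[b bT e].
  have [j [jb jS gj]] := gP b bT.
  have lij : l i = l j by apply: sep; rewrite ?TB ?jb -?gj.
  by rewrite e -(sE b bT) permK lij jb.
have c2 : (#|S2| <= m * #|B :|: D|)%N by apply: card_bigcup_le => a _; exact: hm.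
have c3 : (#|S3| <= m * #|B :|: D|)%N.
  rewrite -cQ; apply: card_bigcup_le => q _.
  have [->|[i0]] := finset.set_0Vmem [set i | [&& i \notin S, l i \in T & c i == q]].
    by rewrite cards0.
  rewrite inE => /and3P[i0S i0T /eqP i0q]; apply: leq_trans (hm (l i0)).
  apply/subset_leq_card/fintype.subsetP => i; rewrite inE => /and3P[iS iT /eqP iq].
  by rewrite inE; apply/eqP/sep; rewrite ?iq ?i0q ?TB.
have cBD : (#|B :|: D| <= #|B| + #|D|)%N by rewrite finset.leq_card_setU.
apply: leq_trans (subset_leq_card sub) _.
apply: leq_trans (finset.leq_card_setU _ _) _.
apply: (@leq_trans (#|S| + #|S2| + #|S3|)); first by rewrite leq_add2r finset.leq_card_setU.
have h4 := leq_mul (leqnn m) cBD.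
by rewrite -addnA leq_add2l mul2n -addnn leq_add // (leq_trans _ h4).
Qed.

Lemma assignmentP (R : realType) (n k : nat) (Phi : 'M[R]_(n, k)) :
  is_assignment Phi ->
  exists c : 'I_n -> 'I_k, forall i j, Phi i j = (c i == j)%:R.
Proof.
move=> [h01 h1].
have /choice [c hc] i : exists a, [set j | Phi i j == 1]%SET = [set a]%SET.
  by apply/cards1P; rewrite h1.
exists c => i j; have /setP/(_ j) := hc i; rewrite !inE => e.
by case: (h01 i j) => h; rewrite h ?eqxx in e *; rewrite eq_sym -e // eq_sym oner_eq0.
Qed.

Lemma Err_label (R : realType) (n k : nat) (M : dcsbm_model R n k)
    (Phi : 'M[R]_(n, k)) (c : 'I_n -> 'I_k) (s : 'S_k) :
  (forall i j, Phi i j = (c i == j)%:R) ->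
  Err M s Phi = [set i | s (c i) != label M i]%SET.
Proof.
move=> hc; apply/setP => i; rewrite !inE; congr negb.
have e1 j : (Phi *m perm_mx s) i j = (s (c i) == j)%:R.
  rewrite mxE (bigD1 (c i)) //= big1 => [|a ai].
    by rewrite hc !mxE eqxx mul1r addr0.
  by rewrite hc eq_sym (negbTE ai) mul0r.
apply/eqP/eqP => [/rowP/(_ (s (c i)))|e].
  rewrite mxE e1 !mxE eqxx [label M i == _]eq_sym; case: eqP => // _ /eqP.
  by rewrite oner_eq0.
by apply/rowP => j; rewrite mxE e1 !mxE e.
Qed.

Lemma bigminn_le (I : finType) (F : I -> nat) (m : nat) (i0 : I) :
  (\big[minn/m]_i F i <= F i0)%N.
Proof.
elim: (index_enum I) (mem_index_enum i0) => // i r IHr.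
rewrite big_cons inE geq_min => /predU1P[->|/IHr ->]; first by rewrite leqnn.
by rewrite orbT.
Qed.

(** * Misclassification by K-means rounding *)

Section Misclassification.
Variables (R : realType) (n k : nat) (M : dcsbm_model R n k).
Variable U : 'M[R]_(n, k).
Hypothesis k_gt0 : (0 < k)%N.
Hypothesis U_unit : forall i, \sum_j U i j ^+ 2 = 1.
Hypothesis U_ge0 : forall i j, 0 <= U i j.

Local Notation l := (label M).
Local Notation C := (community M).

Lemma community_card_gt0 (a : 'I_k) : (0 < #|C a|)%N.
Proof. by have [i <-] := label_surj M a; apply/card_gt0P; exists i; rewrite inE. Qed.

Lemma n_min_le (a : 'I_k) : (n_min M <= #|C a|)%N.
Proof. exact: bigminn_le. Qed.

Lemma n_max_ge (a : 'I_k) : (#|C a| <= n_max M)%N.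
Proof. exact: (leq_bigmax a). Qed.

Lemma n_min_gt0 : (0 < n_min M)%N.
Proof.
have a0 : 'I_k := Ordinal k_gt0.
have n0 : (0 < n)%N by have [i _] := label_surj M a0; apply: leq_ltn_trans (ltn_ord i).
rewrite /n_min; elim/big_rec: _ => // a m _ m0.
by rewrite leq_min community_card_gt0 m0.
Qed.

Lemma n_min_le_max : (n_min M <= n_max M)%N.
Proof. exact: leq_trans (n_min_le (Ordinal k_gt0)) (n_max_ge _). Qed.

Lemma n_le_k_n_max : (n <= k * n_max M)%N.
Proof.
rewrite -[X in (X <= _)%N]card_ord -sum1_card (partition_big l predT) //=.
rewrite -[X in (_ <= X * _)%N]card_ord -sum_nat_const; apply: leq_sum => a _.
apply: leq_trans (n_max_ge a); rewrite -sum1_card.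
by rewrite leq_eqVlt; apply/orP; left; apply/eqP/eq_bigl => i; rewrite inE.
Qed.

Lemma theta_min_le (i : 'I_n) : theta_min M <= theta M i.
Proof.
apply: ge_inf; last by exists i.
by exists 0 => _ [j _ <-]; exact/ltW/theta_gt0.
Qed.

Lemma theta_min_gt0 : 0 < theta_min M.
Proof.
have [i0 _] := label_surj M (Ordinal k_gt0).
have [j _ hj] := @arg_minP _ _ _ i0 predT (theta M) isT.
apply: lt_le_trans (theta_gt0 M j) _; apply: lb_le_inf; first by exists (theta M i0), i0.
by move=> _ [i _ <-]; exact: hj.
Qed.

Lemma sum_label (F : 'I_n -> R) : \sum_i F i = \sum_a \sum_(i in C a) F i.
Proof.
rewrite (partition_big l predT) //=; apply: eq_bigr => a _.
by apply: eq_bigl => i; rewrite inE.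
Qed.

Definition gram_gap : 'M[R]_n := U *m U^T - Phi_star M *m (Phi_star M)^T.

Lemma Phi_star_gram i j : (Phi_star M *m (Phi_star M)^T) i j = (l i == l j)%:R.
Proof.
rewrite mxE (bigD1 (l i)) //= big1 => [|a ai].
  by rewrite !mxE eqxx mul1r addr0 eq_sym.
by rewrite !mxE eq_sym (negbTE ai) mul0r.
Qed.

Lemma gram_gapE i j :
  gram_gap i j = \sum_c U i c * U j c - (l i == l j)%:R.
Proof.
rewrite /gram_gap mxE [X in _ + X]mxE Phi_star_gram mxE; congr (_ - _).
by apply: eq_bigr => c _; rewrite mxE.
Qed.

Lemma gram_ge0 i j : 0 <= \sum_c U i c * U j c.
Proof. by apply: sumr_ge0 => c _; rewrite mulr_ge0. Qed.

Lemma gram_le1 i j : \sum_c U i c * U j c <= 1.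
Proof.
apply: (@le_trans _ _ (\sum_c (U i c ^+ 2 + U j c ^+ 2) / 2)).
  apply: ler_sum => c _; have := sqr_ge0 (U i c - U j c); nra.
rewrite -mulr_suml big_split /= !U_unit; lra.
Qed.

Lemma abs_gram_gap i j : `|gram_gap i j| =
  if l i == l j then 1 - \sum_c U i c * U j c else \sum_c U i c * U j c.
Proof.
rewrite gram_gapE; case: eqP => _; last by rewrite subr0 ger0_norm ?gram_ge0.
by rewrite ler0_norm ?subr_le0 ?gram_le1 // opprB.
Qed.

Definition center : 'M[R]_k :=
  \matrix_(a, c) ((\sum_(i in C a) U i c) / #|C a|%:R).

Definition center_dot (a b : 'I_k) : R := \sum_c center a c * center b c.

Lemma center_dot_gram a b :
  \sum_(i in C a) \sum_(j in C b) \sum_c U i c * U j c =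
  #|C a|%:R * #|C b|%:R * center_dot a b.
Proof.
have nz (e : 'I_k) : #|C e|%:R != 0 :> R by rewrite pnatr_eq0 -lt0n community_card_gt0.
under eq_bigr do rewrite exchange_big /=.
rewrite exchange_big mulr_sumr; apply: eq_bigr => c _ /=.
under eq_bigr do rewrite -mulr_sumr.
rewrite -mulr_suml !mxE; set x := \sum_(i in C a) _; set y := \sum_(i in C b) _.
by field; rewrite !nz.
Qed.

(** The mean entry of [|gram_gap|] on the block of communities [a] and [b]. *)
Definition block_gap (a b : 'I_k) : R :=
  if a == b then 1 - center_dot a a else center_dot a b.

(** Within a block all entries of [gram_gap] have the same sign, so the sum of
    their absolute values is a quantity of the two means only. *)
Lemma block_gapE a b :
  \sum_(i in C a) \sum_(j in C b) `|gram_gap i j| =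
  #|C a|%:R * #|C b|%:R * block_gap a b.
Proof.
rewrite /block_gap; case: (eqVneq a b) => [<-|ab].
  rewrite mulrBr -center_dot_gram mulr1.
  have -> : #|C a|%:R * #|C a|%:R = \sum_(i in C a) \sum_(j in C a) 1 :> R.
    by rewrite !sumr_const mulr_natr.
  rewrite -sumrB; apply: eq_bigr => i; rewrite inE => /eqP ia.
  rewrite -sumrB; apply: eq_bigr => j; rewrite inE => /eqP ja.
  by rewrite abs_gram_gap ia ja eqxx.
rewrite -center_dot_gram; apply: eq_bigr => i; rewrite inE => /eqP ia.
apply: eq_bigr => j; rewrite inE => /eqP ja.
by rewrite abs_gram_gap ia ja (negbTE ab).
Qed.

Lemma block_gap_ge0 a b : 0 <= block_gap a b.
Proof.
have h (e : 'I_k) : 0 < #|C e|%:R :> R by rewrite ltr0n community_card_gt0.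
rewrite -(pmulr_rge0 _ (mulr_gt0 (h a) (h b))) -block_gapE.
by do 2!apply: sumr_ge0 => ? _.
Qed.

Definition gap_norm1 : R := \sum_i \sum_j `|gram_gap i j|.

Lemma gap_norm1E :
  gap_norm1 = \sum_a \sum_b #|C a|%:R * #|C b|%:R * block_gap a b.
Proof.
rewrite /gap_norm1 sum_label; apply: eq_bigr => a _.
under eq_bigr do rewrite sum_label.
by rewrite exchange_big; apply: eq_bigr => b _; exact: block_gapE.
Qed.

Lemma gap_norm1_theta : theta_min M ^+ 2 * gap_norm1 <= norm1theta M gram_gap.
Proof.
have t0 := ltW theta_min_gt0.
rewrite mulr_sumr; apply: ler_sum => i _; rewrite mulr_sumr; apply: ler_sum => j _.
rewrite mulrC -mulrA ler_wpM2l // expr2.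
by apply: ler_pM => //; exact: theta_min_le.
Qed.

Lemma sum_block_gap : (n_min M)%:R ^+ 2 * (\sum_a \sum_b block_gap a b) <= gap_norm1.
Proof.
rewrite gap_norm1E mulr_sumr; apply: ler_sum => a _.
rewrite mulr_sumr; apply: ler_sum => b _.
by rewrite ler_wpM2r ?block_gap_ge0 // expr2 ler_pM // ler_nat n_min_le.
Qed.

(** Each row being a unit vector, the variance of the rows of a community is one
    minus the squared norm of their mean. *)
Lemma kmeans_obj_center :
  kmeans_obj U (Phi_star M) center = \sum_a #|C a|%:R * block_gap a a.
Proof.
rewrite /kmeans_obj sum_label; apply: eq_bigr => a _.
rewrite /block_gap eqxx.
have nz : #|C a|%:R != 0 :> R by rewrite pnatr_eq0 -lt0n community_card_gt0.
have rowE i c : i \in C a -> (Phi_star M *m center - U) i c = center a c - U i c.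
  rewrite inE => /eqP ia; rewrite mxE [X in _ + X]mxE; congr (_ - _).
  rewrite mxE (bigD1 a) //= big1 => [|b ba]; last by rewrite mxE ia eq_sym (negbTE ba) mul0r.
  by rewrite mxE ia eqxx mul1r addr0.
have -> : \sum_(i in C a) \sum_c (Phi_star M *m center - U) i c ^+ 2 =
   \sum_(i in C a) (\sum_c center a c * center a c
     - 2 * (\sum_c center a c * U i c) + 1).
  apply: eq_bigr => i ia; rewrite -[X in _ = _ + X](U_unit i) mulr_sumr -sumrB -big_split /=.
  by apply: eq_bigr => c _; rewrite rowE //; ring.
rewrite big_split sumrB /= -mulr_sumr [X in _ - 2 * X]exchange_big /=.
have -> : \sum_c \sum_(i in C a) center a c * U i c = #|C a|%:R * center_dot a a.
  rewrite mulr_sumr; apply: eq_bigr => c _; rewrite -mulr_sumr.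
  have -> : \sum_(i in C a) U i c = #|C a|%:R * center a c by rewrite mxE mulrC divfK.
  by ring.
have sumC (x : R) : \sum_(i in C a) x = #|C a|%:R * x by rewrite sumr_const mulr_natl.
by rewrite !sumC /center_dot; ring.
Qed.

Lemma kmeans_obj_center_le :
  (n_min M)%:R * kmeans_obj U (Phi_star M) center <= gap_norm1.
Proof.
rewrite kmeans_obj_center gap_norm1E mulr_sumr; apply: ler_sum => a _.
rewrite (bigD1 a) //=; apply: (@le_trans _ _ (#|C a|%:R * #|C a|%:R * block_gap a a)).
  rewrite -mulrA; apply: ler_wpM2r; last by rewrite ler_nat n_min_le.
  by rewrite mulr_ge0 ?block_gap_ge0.
by rewrite lerDl sumr_ge0 // => b _; rewrite !mulr_ge0 ?block_gap_ge0.
Qed.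

Lemma Phi_star_assignment : is_assignment (Phi_star M).
Proof.
split=> [i j|i]; first by rewrite mxE; case: eqP; [right|left].
rewrite (_ : [set j | _]%SET = [set l i]%SET) ?cards1 //.
apply/setP => a; rewrite !inE mxE [a == _]eq_sym.
by case: (l i == a); rewrite ?eqxx // eq_sym oner_eq0.
Qed.

Lemma kmeans_opt_le (Phi : 'M[R]_(n, k)) (X : 'M[R]_k) :
  is_assignment Phi -> kmeans_opt U <= kmeans_obj U Phi X.
Proof.
move=> hPhi; apply: ge_inf; last by exists (Phi, X).
by exists 0 => _ [[P Y] _ <-]; do 2!apply: sumr_ge0 => ? _; exact: sqr_ge0.
Qed.

Section Rounding.
Variables (Phi : 'M[R]_(n, k)) (X : 'M[R]_k) (c : 'I_n -> 'I_k).
Hypothesis PhiE : forall i j, Phi i j = (c i == j)%:R.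

Definition dist_center (q a : 'I_k) : R := \sum_j (X q j - center a j) ^+ 2.

Definition far_nodes : {set 'I_n} := [set i | 4^-1 <= dist_center (c i) (l i)]%SET.

(** A block gap above 1/4 spoils the separation of the mean of [a] from the mean
    of another community, or makes this mean short. *)
Definition bad_communities : {set 'I_k} :=
  [set a | [exists b, 4^-1 < block_gap a b]]%SET.

(** The cost of the true means is at most [gap_norm1 / n_min], that of the output
    is at most [alpha] times as much, and the output centers are compared with
    the means by the triangle inequality through the rows of [U]. *)
Lemma card_far_nodes (alpha : R) : 0 <= alpha -> kmeans_approx alpha U Phi X ->
  #|far_nodes|%:R * (n_min M)%:R <= 8 * (1 + alpha) * gap_norm1.
Proof.
move=> alpha_ge0 [_ h3].
have clusterE (Y : 'M[R]_k) (P : 'M[R]_(n, k)) (e : 'I_n -> 'I_k) i j :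
    (forall i j, P i j = (e i == j)%:R) -> (P *m Y) i j = Y (e i) j.
  move=> hP; rewrite mxE (bigD1 (e i)) //= big1 => [|b bi].
    by rewrite hP eqxx mul1r addr0.
  by rewrite hP eq_sym (negbTE bi) mul0r.
have PsE i j : Phi_star M i j = (l i == j)%:R by rewrite mxE.
have h1 : #|far_nodes|%:R <= 4 * \sum_i dist_center (c i) (l i).
  rewrite mulr_sumr -sum1_card natr_sum big_mkcond /=; apply: ler_sum => i _.
  rewrite inE; case: ifP => [|_]; first by lra.
  by rewrite mulr_ge0 // sumr_ge0 // => j _; exact: sqr_ge0.
have h2 : \sum_i dist_center (c i) (l i) <=
    2 * (kmeans_obj U Phi X + kmeans_obj U (Phi_star M) center).
  rewrite -big_split mulr_sumr; apply: ler_sum => i _.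
  rewrite -big_split mulr_sumr; apply: ler_sum => j _ /=.
  rewrite ![(_ *m _ - U) i j]mxE !(clusterE _ _ _ _ _ PhiE) !(clusterE _ _ _ _ _ PsE).
  rewrite [(- U) i j]mxE.
  have := sqr_ge0 (X (c i) j - U i j + (center (l i) j - U i j)); nra.
have h4 : kmeans_opt U <= kmeans_obj U (Phi_star M) center.
  exact: kmeans_opt_le Phi_star_assignment.
have h5 := kmeans_obj_center_le.
have h6 := ler_wpM2l alpha_ge0 h4.
have m0 : 0 <= (n_min M)%:R :> R by [].
have h7 : #|far_nodes|%:R <= 8 * (1 + alpha) * kmeans_obj U (Phi_star M) center by lra.
have h8 := ler_wpM2r m0 h7.
have h9 : 0 <= 8 * (1 + alpha) by rewrite mulr_ge0 // addr_ge0.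
by have := ler_wpM2l h9 h5; lra.
Qed.

Lemma card_bad_communities :
  #|bad_communities|%:R * (n_min M)%:R ^+ 2 <= 4 * gap_norm1.
Proof.
apply: le_trans (_ : 4 * ((n_min M)%:R ^+ 2 * (\sum_a \sum_b block_gap a b)) <= _); last first.
  by rewrite ler_wpM2l // sum_block_gap.
rewrite mulrC mulrCA ler_wpM2l ?sqr_ge0 //.
rewrite mulr_sumr -sum1_card natr_sum big_mkcond /=; apply: ler_sum => a _.
have s0 (P : pred 'I_k) : 0 <= \sum_(b | P b) block_gap a b.
  by apply: sumr_ge0 => b _; exact: block_gap_ge0.
rewrite inE; case: ifP => [/existsP[b hb]|_]; last by rewrite mulr_ge0 ?s0.
by rewrite (bigD1 b) //=; have := s0 (fun e => e != b); lra.
Qed.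

(** The squared distance of the means of two communities that are not bad is at
    least [3/4 + 3/4 - 2 * 1/4 = 1], and a common center at squared distance
    less than 1/4 from both would make it less than 1. *)
Lemma far_bad_separated (i j : 'I_n) :
  i \notin far_nodes -> j \notin far_nodes ->
  l i \notin bad_communities -> l j \notin bad_communities ->
  c i = c j -> l i = l j.
Proof.
rewrite !inE -!ltNge !negb_exists => hi hj /forallP bi /forallP bj cij.
apply/eqP; apply: contraTT isT => lij.
move: (bi (l i)) (bj (l j)) (bi (l j)).
rewrite -!leNgt /block_gap !eqxx (negbTE lij) /center_dot => h1 h2 h3.
move: hi hj; rewrite -cij /dist_center => hi hj.
have : \sum_e (center (l i) e - center (l j) e) ^+ 2 <=
    2 * (\sum_e (X (c i) e - center (l i) e) ^+ 2 +
         \sum_e (X (c i) e - center (l j) e) ^+ 2).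
  rewrite -big_split mulr_sumr; apply: ler_sum => e _ /=.
  have := sqr_ge0 (X (c i) e - center (l i) e + (X (c i) e - center (l j) e)); nra.
have -> : \sum_e (center (l i) e - center (l j) e) ^+ 2 =
    \sum_e center (l i) e * center (l i) e + \sum_e center (l j) e * center (l j) e
    - 2 * \sum_e center (l i) e * center (l j) e.
  by rewrite mulr_sumr -big_split -sumrB; apply: eq_bigr => e _ /=; ring.
lra.
Qed.

(** A community all of whose nodes are far contains at least [n_min] of them. *)
Lemma min_err_le_count : (min_err M Phi)%:R <= #|far_nodes|%:R +
  2 * (n_max M)%:R * (#|bad_communities|%:R + #|far_nodes|%:R / (n_min M)%:R) :> R.
Proof.
have [s hs] := cluster_matching n_max_ge far_bad_separated.
have m0 : 0 < (n_min M)%:R :> R by rewrite ltr0n n_min_gt0.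
set D := [set a | _ \subset _]%SET in hs.
have hD : #|D|%:R <= #|far_nodes|%:R / (n_min M)%:R :> R.
  rewrite ler_pdivlMr // -natrM ler_nat.
  rewrite -sum_nat_const.
  apply: (@leq_trans (\sum_(a in D) #|C a|)%N).
    by apply: leq_sum => a _; exact: n_min_le.
  have -> : #|far_nodes| = (\sum_a #|C a :&: far_nodes|)%N.
    rewrite -sum1_card (partition_big l predT) //=; apply: eq_bigr => a _.
    by rewrite -sum1_card; apply: eq_bigl => i; rewrite !inE andbC.
  rewrite big_mkcond; apply: leq_sum => a _; rewrite inE.
  by rewrite -/(C a); case: ifP => // /finset.setIidPl ->.
have : (min_err M Phi <= #|far_nodes| + 2 * (n_max M * (#|bad_communities| + #|D|)))%N.
  apply: leq_trans hs; rewrite -(Err_label M s PhiE); exact: bigminn_le.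
rewrite -(ler_nat R) natrD !natrM natrD => h; apply: le_trans h _.
by rewrite lerD2l mulrA ler_wpM2l ?mulr_ge0 // lerD2l.
Qed.

End Rounding.

(** With [t = sqrt gap_norm1 / n_min] and [w = (1 + rho) * (1 + alpha) * t], where
    [rho = n_max / n_min], the counts give at most [24 * w * t * n_max] errors.
    If [8 * w < sqrt k] this is at most [3 * sqrt k * t * n_max]; otherwise the
    claimed bound is at least [k * n_max]. *)
Theorem min_err_bound (alpha : R) (Phi : 'M[R]_(n, k)) (X : 'M[R]_k) :
  0 <= alpha -> kmeans_approx alpha U Phi X ->
  (min_err M Phi)%:R <=
     8 * Num.sqrt k%:R * (n_max M)%:R / (theta_min M * (n_min M)%:R)
     * (1 + (n_max M)%:R / (n_min M)%:R) * (1 + alpha)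
     * Num.sqrt (norm1theta M gram_gap).
Proof.
move=> a0 hk; have [c PhiE] := assignmentP hk.1.
have m0 : 0 < (n_min M)%:R :> R by rewrite ltr0n n_min_gt0.
have t0 := theta_min_gt0.
have L0 : 0 <= gap_norm1 by do 2!apply: sumr_ge0 => ? _.
pose t : R := Num.sqrt gap_norm1 / (n_min M)%:R.
pose rho := (n_max M)%:R / (n_min M)%:R : R.
have tt0 : 0 <= t by rewrite divr_ge0 ?sqrtr_ge0.
have Lt : gap_norm1 = t ^+ 2 * (n_min M)%:R ^+ 2.
  by rewrite -exprMn divfK ?gt_eqF // sqr_sqrtr.
have Mx : (n_max M)%:R = rho * (n_min M)%:R :> R by rewrite divfK ?gt_eqF.
have rho1 : 1 <= rho by rewrite ler_pdivlMr // mul1r ler_nat n_min_le_max.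
set sk := Num.sqrt k%:R : R.
have sk2 : sk ^+ 2 = k%:R by rewrite sqr_sqrtr.
have sk0 : 0 <= sk by rewrite sqrtr_ge0.
have hs := card_far_nodes PhiE a0 hk; have hb := card_bad_communities.
have he := min_err_le_count X PhiE.
set S : R := #|far_nodes _ _|%:R in hs he.
set B : R := #|bad_communities|%:R in hb he.
have hn : (min_err M Phi)%:R <= sk ^+ 2 * (rho * (n_min M)%:R).
  rewrite sk2 -Mx -natrM ler_nat; apply: leq_trans n_le_k_n_max.
  rewrite /min_err; elim/big_rec: _ => // s m _ h.
  by rewrite geq_min h orbT.
clearbody t rho; set N : R := (n_min M)%:R in m0 Lt Mx hs hb he hn *.
rewrite Mx.
have sqL : theta_min M * (t * N) <= Num.sqrt (norm1theta M gram_gap).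
  have h : 0 <= theta_min M * (t * N) by rewrite !mulr_ge0 // ltW.
  rewrite -(ger0_norm h) -sqrtr_sqr ler_wsqrtr //.
  by rewrite exprMn [(t * N) ^+ 2]exprMn -Lt gap_norm1_theta.
apply: (@le_trans _ _ (8 * sk * (rho * N) * (1 + rho) * (1 + alpha) * t)); last first.
  have -> : 8 * sk * (rho * N) / (theta_min M * N) * (1 + rho * N / N) * (1 + alpha) =
     8 * sk * (rho * N) / (theta_min M * N) * (1 + rho) * (1 + alpha).
    by rewrite mulfK ?gt_eqF.
  have -> : 8 * sk * (rho * N) * (1 + rho) * (1 + alpha) * t =
     8 * sk * (rho * N) / (theta_min M * N) * (1 + rho) * (1 + alpha) *
     (theta_min M * (t * N)).
    by field; rewrite !gt_eqF.
  apply: ler_wpM2l sqL.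
  by rewrite !mulr_ge0 ?invr_ge0 ?mulr_ge0 ?addr_ge0 //; try exact: ltW; lra.
pose w := (1 + rho) * (1 + alpha) * t.
have -> : 8 * sk * (rho * N) * (1 + rho) * (1 + alpha) * t = 8 * sk * (rho * N) * w.
  by rewrite /w; ring.
have rN : 0 < rho * N by rewrite mulr_gt0 //; lra.
(* In the first case the claimed bound is at least the number of nodes. *)
have [hw|hw] := leP sk (8 * w).
  apply: le_trans hn _.
  have -> : 8 * sk * (rho * N) * w = sk * (8 * w) * (rho * N) by ring.
  by rewrite ler_pM2r // expr2 ler_wpM2l.
have hS : S <= 8 * (1 + alpha) * t ^+ 2 * N.
  by rewrite -(ler_pM2r m0) (le_trans hs) // Lt expr2 !mulrA.
have hB : B <= 4 * t ^+ 2.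
  by rewrite -(ler_pM2r (exprn_gt0 2 m0)) (le_trans hb) // Lt mulrA.
have w_ge_t : 2 * t <= w.
  rewrite /w; have : 2 <= (1 + rho) * (1 + alpha) by nra.
  by move=> h; rewrite ler_wpM2r.
apply: le_trans he _; rewrite Mx.
have -> : S + 2 * (rho * N) * (B + S / N) = S * (1 + 2 * rho) + 2 * (rho * N) * B.
  by field; rewrite gt_eqF.
have e1 : S * (1 + 2 * rho) <= 16 * (w * t) * N.
  apply: le_trans (ler_wpM2r _ hS) _; first lra.
  have -> : 16 * (w * t) * N = 8 * (1 + alpha) * t ^+ 2 * N * (2 + 2 * rho).
    by rewrite /w; ring.
  have p : 0 <= 8 * (1 + alpha) * t ^+ 2 * N.
    by rewrite mulr_ge0 ?(ltW m0) // mulr_ge0 ?sqr_ge0 // mulr_ge0 // addr_ge0.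
  apply: ler_wpM2l => //; lra.
have e2 : 2 * (rho * N) * B <= 8 * (rho * N) * (w * t).
  have : B <= 4 * (w * t) by apply: le_trans hB _; rewrite expr2; nra.
  by move=> h; have := ler_wpM2l (ltW rN) h; lra.
have e3 : 16 * (w * t) * N <= 16 * (w * t) * (rho * N).
  have wt : 0 <= w * t by rewrite mulr_ge0 //; lra.
  by apply: ler_wpM2l; [rewrite mulr_ge0 | rewrite ler_peMl // ltW].
have e4 : 8 * (w * t) <= sk * t by rewrite mulrA ler_wpM2r // ltW.
have e5 : 24 * (w * t) * (rho * N) <= 3 * (sk * t) * (rho * N) by rewrite ler_pM2r //; lra.
have e6 : sk * t <= sk * w by rewrite ler_wpM2l //; lra.
have e7 : 3 * (sk * t) * (rho * N) <= 8 * (sk * w) * (rho * N).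
  rewrite ler_pM2r //; have : 0 <= sk * t by rewrite mulr_ge0.
  lra.
lra.
Qed.

End Misclassification.

(** * Finite families of independent Bernoulli variables *)

(** From [exp (- y / 2) >= 1 - y / 2] one gets [exp y <= (1 - y / 2)^-2], and this
    is below the quadratic exactly because [(1 - y) * (5 - 2 * y) >= 0]. *)
Lemma expR_le_quadratic (R : realType) (y : R) : y <= 1 ->
  expR y <= 1 + y + 2 * y ^+ 2.
Proof.
move=> y1; set E := expR (y / 2).
have E0 : 0 < E by exact: expR_gt0.
have EE : E * expR (- (y / 2)) = 1 by rewrite -expRD subrr expR0.
have hE : E * (1 - y / 2) <= 1 by rewrite -[leRHS]EE ler_pM2l // expR_ge1Dx.
have q0 : 0 < 1 - y / 2 by lra.
have -> : expR y = E * E by rewrite -expRD -mulrDl -mulr2n -[y *+ 2]mulr_natr mulfK.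
rewrite -(ler_pM2r (mulr_gt0 q0 q0)).
have -> : E * E * ((1 - y / 2) * (1 - y / 2)) = (E * (1 - y / 2)) * (E * (1 - y / 2)).
  by ring.
have h0 : 0 <= E * (1 - y / 2) by rewrite mulr_ge0 // ltW.
apply: (@le_trans _ _ (1 * 1)); first exact: ler_pM.
have -> : (1 + y + 2 * y ^+ 2) * ((1 - y / 2) * (1 - y / 2)) =
  1 + y ^+ 2 * ((1 - y) * (5 - 2 * y) / 4) by field.
rewrite mulr1 lerDl mulr_ge0 ?sqr_ge0 // divr_ge0 // mulr_ge0 //; lra.
Qed.

(** Write the left side as [exp (- y * p) * (1 + p * (exp y - 1))] and use
    [1 + z <= exp z]; the variance proxy is [p], not 1/4, which is what keeps
    the noise bound sharp for sparse graphs. *)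
Lemma bernoulli_mgf (R : realType) (p y : R) : 0 <= p <= 1 -> y <= 1 ->
  p * expR (y * (1 - p)) + (1 - p) * expR (y * (0 - p)) <= expR (2 * y ^+ 2 * p).
Proof.
move=> /andP[p0 p1] y1.
have -> : expR (y * (1 - p)) = expR y * expR (- (y * p)).
  by rewrite -expRD mulrBr mulr1.
rewrite sub0r mulrN mulrA -mulrDl.
have -> : 2 * y ^+ 2 * p = 2 * y ^+ 2 * p + y * p + - (y * p) by ring.
rewrite expRD ler_pM2r ?expR_gt0 //.
apply: le_trans (expR_ge1Dx _).
have := ler_wpM2l p0 (expR_le_quadratic y1); lra.
Qed.

Section BernoulliLaw.
Variables (R : realType) (I : finType) (D : {set I}) (p : I -> R).

(** Configurations are set to [false] outside [D], so that each outcome on [D]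
    is represented once. *)
Definition configs : {pred {ffun I -> bool}} := pffun_on false (mem D) (mem predT).

Definition law (v : {ffun I -> bool}) : R :=
  \prod_(e in D) (if v e then p e else 1 - p e).

(** Expectations of products factor; both the mean of one variable and the
    exponential moments are instances. *)
Lemma law_prod (g : I -> bool -> R) :
  \sum_(v in configs) law v * \prod_(e in D) g e (v e) =
  \prod_(e in D) (p e * g e true + (1 - p e) * g e false).
Proof.
have -> : \prod_(e in D) (p e * g e true + (1 - p e) * g e false) =
    \prod_(e in D) \sum_(b in predT) (if b then p e else 1 - p e) * g e b.
  by apply: eq_bigr => e _; rewrite big_bool.
rewrite (big_distr_big false) /=; apply: eq_bigr => v _.
by rewrite -big_split.
Qed.

Lemma law_mean (e0 : I) : e0 \in D -> \sum_(v in configs) law v * (v e0)%:R = p e0.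
Proof.
move=> e0D; pose g e (b : bool) : R := if e == e0 then b%:R else 1.
have := law_prod g; rewrite [RHS](bigD1 e0) //= [X in _ * X]big1 => [|e /andP[_ ne]].
  rewrite /g eqxx mulr1 mulr0 addr0 mulr1 => <-; apply: eq_bigr => v _.
  rewrite (bigD1 e0) //= eqxx big1 ?mulr1 // => e /andP[_ ne].
  by rewrite (negbTE ne).
by rewrite /g (negbTE ne) !mulr1 addrC subrK.
Qed.

Hypothesis p01 : forall e, 0 <= p e <= 1.

Lemma law_ge0 v : 0 <= law v.
Proof.
by apply: prodr_ge0 => e _; have /andP[p0 p1] := p01 e; case: ifP; rewrite ?subr_ge0.
Qed.

Lemma law_chernoff (s : R) (a : I -> R) : (forall e, s * a e <= 1) ->
  \sum_(v in configs) law v * expR (s * \sum_(e in D) a e * ((v e)%:R - p e)) <=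
  expR (\sum_(e in D) 2 * (s * a e) ^+ 2 * p e).
Proof.
move=> sa; pose g e (b : bool) := expR (s * a e * (b%:R - p e)).
have -> : \sum_(v in configs) law v * expR (s * \sum_(e in D) a e * ((v e)%:R - p e)) =
    \sum_(v in configs) law v * \prod_(e in D) g e (v e).
  apply: eq_bigr => v _; congr (_ * _); rewrite mulr_sumr expR_sum.
  by apply: eq_bigr => e _; rewrite /g mulrA.
rewrite law_prod expR_sum; apply: ler_prod => e _; apply/andP; split.
  have /andP[p0 p1] := p01 e.
  by rewrite addr_ge0 // mulr_ge0 ?expR_ge0 // subr_ge0.
exact: bernoulli_mgf.
Qed.

Variables (d : measure_display) (T : measurableType d) (P : probability T R).
Variable A : I -> {RV P >-> bool}.
Hypothesis A_indep : mutual_indep P D (fun e w => A e w).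
Hypothesis A_prob : forall e, e \in D -> P [set w | A e w = true]%classic = (p e)%:E.

Definition config (w : T) : {ffun I -> bool} := [ffun e => (e \in D) && A e w].

Lemma measurable_coordinate e (b : bool) : measurable [set w | A e w = b]%classic.
Proof.
have mb : measurable [set b]%classic by [].
exact: (measurable_funPTI (A e) mb).
Qed.

Lemma prob_coordinate e (b : bool) : e \in D ->
  P [set w | A e w = b]%classic = (if b then p e else 1 - p e)%:E.
Proof.
move=> eD; case: b; first exact: A_prob.
have -> : [set w | A e w = false]%classic = (~` [set w | A e w = true])%classic.
  by apply/seteqP; split => w /=; case: (A e w).
by rewrite probability_setC ?A_prob //; exact: measurable_coordinate.
Qed.

Definition atom (v : {ffun I -> bool}) : set T :=
  [set w | forall e, e \in D -> A e w = v e]%classic.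

Lemma measurable_atom v : measurable (atom v).
Proof.
have -> : atom v = (\bigcap_(e in [set e | e \in D]) [set w | A e w = v e])%classic by [].
apply: fin_bigcap_measurable => [|e _]; first exact: finite_finset.
exact: measurable_coordinate.
Qed.

Lemma prob_atom v : P (atom v) = (law v)%:E.
Proof.
rewrite /atom A_indep // -prodEFin; apply: eq_bigr => e eD.
by rewrite prob_coordinate.
Qed.

Lemma config_event (Q : pred {ffun I -> bool}) :
  [set w | Q (config w)]%classic =
  (\big[setU/set0]_(v in configs | Q v) atom v)%classic.
Proof.
apply/seteqP; split => w /=.
  move=> Qw; rewrite (bigD1 (config w)) /=; last first.
    rewrite Qw andbT; apply/pffun_onP; split.
      by apply/fintype.subsetP => e; rewrite inE ffunE; case: (e \in D).
    by move=> b _.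
  by left => e eD; rewrite ffunE eD.
elim/big_rec: _ => // v S /andP[vc Qv] IH [hw|]; last exact: IH.
have -> // : config w = v.
apply/ffunP => e; rewrite ffunE; have [eD|eD] := boolP (e \in D); first exact: hw.
case: (pffun_onP vc) => /fintype.subsetP/(_ e) h _.
by move: h; rewrite inE (negbTE eD); case: (v e) => // /(_ isT).
Qed.

Lemma measurable_config (Q : pred {ffun I -> bool}) :
  measurable [set w | Q (config w)]%classic.
Proof.
by rewrite config_event; apply: bigsetU_measurable => v _; exact: measurable_atom.
Qed.

(** Subadditivity over the atoms.  One inequality suffices, since it is applied
    to the exceptional event. *)
Lemma prob_config_le (Q : pred {ffun I -> bool}) :
  (P [set w | Q (config w)]%classic <= (\sum_(v in configs | Q v) law v)%:E)%E.
Proof.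
rewrite config_event.
suff : measurable (\big[setU/set0]_(v in configs | Q v) atom v)%classic /\
  (P (\big[setU/set0]_(v in configs | Q v) atom v)%classic <=
   (\sum_(v in configs | Q v) law v)%:E)%E by case.
elim/big_rec2: _ => [|v s S _ [mS hS]]; first by rewrite measure0; split.
split; first by apply: measurableU => //; exact: measurable_atom.
apply: le_trans (measureU2 _ (measurable_atom v) mS) _.
have h : (P (atom v) <= (law v)%:E)%E by rewrite prob_atom.
exact: leeD h hS.
Qed.

End BernoulliLaw.

(** * Perturbation of the relaxed problem *)

Lemma innerE (R : realType) (m q : nat) (X Y : 'M[R]_(m, q)) :
  inner X Y = \sum_i \sum_j X i j * Y i j.
Proof.
rewrite /inner /mxtrace exchange_big; apply: eq_bigr => j _.
by rewrite mxE; apply: eq_bigr => i _; rewrite mxE.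
Qed.

Section PopulationModel.
Variables (R : realType) (n k : nat) (M : dcsbm_model R n k).
Hypothesis H_gt0 : forall a, 0 < H_ M a.

Local Notation l := (label M).
Local Notation F := (f_norm1 M).

Definition edge_prob (e : 'I_n * 'I_n) : R :=
  conn M (l e.1) (l e.2) * theta M e.1 * theta M e.2.

Lemma edge_prob01 e : 0 <= edge_prob e <= 1.
Proof.
have /andP[c0 _] := conn01 M (l e.1) (l e.2).
by rewrite prob_le1 andbT !mulr_ge0 // ltW // theta_gt0.
Qed.

Lemma f_sum (i : 'I_n) : f_ M i = \sum_j edge_prob (i, j).
Proof.
rewrite (sum_label M) /f_ /H_ mulr_suml; apply: eq_bigr => b _.
rewrite /G_ mulr_sumr mulr_suml; apply: eq_bigr => j.
by rewrite inE => /eqP jb; rewrite /edge_prob /= jb mulrAC.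
Qed.

Lemma f_gt0 (i : 'I_n) : 0 < f_ M i.
Proof. by rewrite mulr_gt0 // theta_gt0. Qed.

Lemma f_norm1E : F = \sum_i f_ M i.
Proof. by apply: eq_bigr => i _; rewrite gtr0_norm // f_gt0. Qed.

Lemma f_norm1_sum : F = \sum_i \sum_j edge_prob (i, j).
Proof. by rewrite f_norm1E; apply: eq_bigr => i _; exact: f_sum. Qed.

(** The diagonal is set to zero: the mean of the adjacency matrix has no
    diagonal, whereas that of [edge_prob] is needed for its rows to sum
    to [f_]. *)
Definition noise (A : 'M[R]_n) : 'M[R]_n :=
  \matrix_(i, j) (if i == j then 0 else A i j - edge_prob (i, j)).

Section Deterministic.
Variables (U : 'M[R]_(n, k)) (A : 'M[R]_n) (p : nat) (lambda delta t : R).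
Hypothesis p_gt0 : (0 < p)%N.
Hypothesis A_ge0 : forall i j, 0 <= A i j.
Hypothesis A_diag : forall i, A i i = 0.
Hypothesis A_noise : sign_bound (noise A) t.
Hypothesis A_total : \sum_i \sum_j A i j <= 100 * F.
Hypothesis lambda_ge0 : 0 <= lambda.
Hypothesis diag_gap : forall a, lambda * H_ M a ^+ 2 + delta <= conn M a a.
Hypothesis offdiag_gap : forall a b, a != b ->
  conn M a b + delta <= lambda * (H_ M a * H_ M b).
Hypothesis U_opt : relax_opt p lambda A U.

Local Notation Delta := (gram_gap M U).

Let U_unit i : \sum_j U i j ^+ 2 = 1. Proof. by case: U_opt => -[]. Qed.
Let U_ge0 i j : 0 <= U i j. Proof. by case: U_opt => -[]. Qed.

Definition deg (i : 'I_n) : R := \sum_j A i j.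

Lemma Phi_star_feasible : relax_feasible p (Phi_star M).
Proof.
split => [i|i|i j]; last by rewrite mxE.
  rewrite (bigD1 (l i)) //= big1 => [|a ai]; first by rewrite mxE eqxx expr1n addr0.
  by rewrite mxE eq_sym (negbTE ai) expr0n.
apply: leq_trans p_gt0; rewrite (_ : [set j | _]%SET = [set l i]%SET) ?cards1 //.
apply/setP => a; rewrite !inE mxE [a == _]eq_sym.
by case: (l i == a); rewrite ?oner_eq0 ?eqxx.
Qed.

(** The true assignment matrix is feasible. *)
Lemma optimality : 0 <= \sum_i \sum_j (A i j - lambda * (deg i * deg j)) * Delta i j.
Proof.
have objE V : relax_obj lambda A V =
    - \sum_i \sum_j (A i j - lambda * (deg i * deg j)) * (V *m V^T) i j.
  rewrite /relax_obj innerE -sumrN; apply: eq_bigr => i _.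
  rewrite -sumrN; apply: eq_bigr => j _; rewrite mxE mulNr; congr (- (_ * _)).
  rewrite mxE [X in _ + X]mxE [X in _ - X]mxE; congr (_ - lambda * _).
  by rewrite mxE big_ord1 !mxE.
have [_ /(_ _ Phi_star_feasible)] := U_opt; rewrite !objE lerN2 -subr_ge0.
rewrite -sumrB; congr (0 <= _); apply: eq_bigr => i _.
rewrite -sumrB; apply: eq_bigr => j _.
by rewrite -mulrBr /gram_gap [X in _ = _ * X]mxE [X in _ = _ * (_ + X)]mxE.
Qed.

(** In the population problem the sign of each coefficient is opposite to that of
    the corresponding entry of [Delta], with a margin [delta]. *)
Lemma population_gap :
  \sum_i \sum_j (edge_prob (i, j) - lambda * (f_ M i * f_ M j)) * Delta i j
  <= - (delta * norm1theta M Delta).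
Proof.
rewrite /norm1theta mulr_sumr -sumrN; apply: ler_sum => i _.
rewrite mulr_sumr -sumrN; apply: ler_sum => j _.
have tt : 0 <= theta M i * theta M j by rewrite mulr_ge0 // ltW // theta_gt0.
have -> : edge_prob (i, j) - lambda * (f_ M i * f_ M j) =
   (conn M (l i) (l j) - lambda * (H_ M (l i) * H_ M (l j))) * (theta M i * theta M j).
  by rewrite /edge_prob /f_ /=; ring.
rewrite (abs_gram_gap M U_unit U_ge0) gram_gapE.
have g0 := gram_ge0 U_ge0 i j; have g1 := gram_le1 U_unit i j.
set g := \sum_c _ in g0 g1 *.
case: (eqVneq (l i) (l j)) => [e|ne].
  have := diag_gap (l j); rewrite e => h.
  have h1 : 0 <= (1 - g) * (theta M i * theta M j) by rewrite mulr_ge0 // subr_ge0.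
  have := ler_wpM2r h1 h; rewrite mulr1n; lra.
have h1 : 0 <= g * (theta M i * theta M j) by rewrite mulr_ge0.
have := ler_wpM2r h1 (offdiag_gap ne); rewrite mulr0n subr0; lra.
Qed.

Lemma gram_gap_diag i : Delta i i = 0.
Proof.
rewrite gram_gapE eqxx -(U_unit i); apply/eqP; rewrite subr_eq0; apply/eqP.
by apply: eq_bigr => c _; rewrite expr2.
Qed.

Lemma gram_gap_le1 i j : `|Delta i j| <= 1.
Proof.
rewrite (abs_gram_gap M U_unit U_ge0); case: ifP => _; last exact: gram_le1.
by have := gram_ge0 U_ge0 i j; lra.
Qed.

(** [Delta] has zero diagonal, so [A - edge_prob] can be replaced with the noise,
    and both Gram matrices in [Delta] are within reach of Grothendieck's
    inequality; the minus sign is absorbed in one family of vectors. *)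
Lemma noise_gap : \sum_i \sum_j (A i j - edge_prob (i, j)) * Delta i j <= 196 * t.
Proof.
have hg := grothendieck A_noise.
have UU i : \sum_c U i c ^+ 2 <= 1 by rewrite U_unit.
have PhiU i : \sum_c Phi_star M i c ^+ 2 <= 1.
  by have [/(_ i) -> _ _] := Phi_star_feasible.
have PhiN i : \sum_c (- Phi_star M i c) ^+ 2 <= 1.
  by under eq_bigr do rewrite sqrrN.
have h1 := hg _ (fun i => U i) (fun i => U i) UU UU.
have h2 := hg _ (fun i c => - Phi_star M i c) (fun i => Phi_star M i) PhiN PhiU.
rewrite (_ : 196 * t = 98 * t + 98 * t); last by ring.
apply: le_trans (lerD h1 h2); rewrite -big_split; apply: ler_sum => i _ /=.
rewrite -big_split; apply: ler_sum => j _ /=.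
rewrite ![noise _ _ _]mxE; case: (eqVneq i j) => [<-|_].
  by rewrite gram_gap_diag !mul0r mulr0 addr0.
rewrite -mulrDr le_eqVlt; apply/orP; left; apply/eqP; congr (_ * _).
rewrite /gram_gap [LHS]mxE [X in _ + X]mxE 2![in LHS]mxE -sumrB -big_split /=.
by apply: eq_bigr => c _; rewrite mxE [X in _ - _ * X]mxE mulNr.
Qed.

(** Testing the noise against the constant sign vector gives the row sums; the
    diagonal of [edge_prob] contributes at most 1 per row. *)
Lemma deg_close : \sum_i `|deg i - f_ M i| <= t + n%:R.
Proof.
have := sign_bound_abs [ffun=> false] A_noise.
move=> h; apply: (@le_trans _ _
  (\sum_i (`|\sum_j noise A i j * (-1) ^+ [ffun=> false] j| + 1))).
  apply: ler_sum => i _.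
  have -> : deg i - f_ M i =
      \sum_j noise A i j * (-1) ^+ [ffun=> false] j - edge_prob (i, i).
    rewrite /deg f_sum -sumrB (bigD1 i) //= A_diag sub0r addrC; congr (_ - _).
    rewrite [RHS](bigD1 i) //= mxE eqxx mul0r add0r; apply: eq_bigr => j ji.
    by rewrite mxE eq_sym (negbTE ji) ffunE expr0 mulr1.
  have /andP[e0 e1] := edge_prob01 (i, i).
  by apply: le_trans (ler_normB _ _) _; rewrite lerD2l ger0_norm.
by rewrite big_split /= sumr_const card_ord lerD2r.
Qed.

(** [|Delta i j| <= 1], and a difference of products of degrees is linear in the
    difference of the degrees. *)
Lemma degree_gap :
  \sum_i \sum_j (f_ M i * f_ M j - deg i * deg j) * Delta i j <= 101 * F * (t + n%:R).
Proof.
have deg_ge0 i : 0 <= deg i by apply: sumr_ge0 => j _.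
apply: (@le_trans _ _
  (\sum_i \sum_j (`|deg i - f_ M i| * deg j + f_ M i * `|deg j - f_ M j|))).
  apply: ler_sum => i _; apply: ler_sum => j _.
  apply: le_trans (ler_mul_abs _ (gram_gap_le1 i j)) _.
  have -> : f_ M i * f_ M j - deg i * deg j =
     - ((deg i - f_ M i) * deg j + f_ M i * (deg j - f_ M j)) by ring.
  rewrite normrN; apply: le_trans (ler_normD _ _) _.
  rewrite [`|_ * deg j|]normrM [`|f_ M i * _|]normrM.
  by rewrite (ger0_norm (deg_ge0 j)) (gtr0_norm (f_gt0 i)).
have -> : \sum_i \sum_j (`|deg i - f_ M i| * deg j + f_ M i * `|deg j - f_ M j|) =
    (\sum_i `|deg i - f_ M i|) * (\sum_j deg j + F).
  under eq_bigr do rewrite big_split /= -!mulr_sumr.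
  by rewrite big_split /= -!mulr_suml -f_norm1E; ring.
have h := deg_close.
have n0 : 0 <= \sum_i `|deg i - f_ M i| by exact: sumr_ge0.
have F0 : 0 <= F by rewrite sumr_ge0.
have dF : \sum_j deg j + F <= 101 * F by have := A_total; rewrite /deg; lra.
rewrite mulrC; apply: ler_pM => //; apply: addr_ge0 => //; exact: sumr_ge0.
Qed.

Theorem gap_bound :
  delta * norm1theta M Delta <= 196 * t + lambda * (101 * F * (t + n%:R)).
Proof.
have h4 := ler_wpM2l lambda_ge0 degree_gap.
suff e : \sum_i \sum_j (A i j - lambda * (deg i * deg j)) * Delta i j =
   \sum_i \sum_j (edge_prob (i, j) - lambda * (f_ M i * f_ M j)) * Delta i j
 + \sum_i \sum_j (A i j - edge_prob (i, j)) * Delta i j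
 + lambda * \sum_i \sum_j (f_ M i * f_ M j - deg i * deg j) * Delta i j.
  by have := optimality; rewrite e; have := population_gap; have := noise_gap; lra.
rewrite mulr_sumr -!big_split; apply: eq_bigr => i _ /=.
rewrite mulr_sumr -!big_split; apply: eq_bigr => j _ /=.
by ring.
Qed.

End Deterministic.
End PopulationModel.

(** * Concentration of the random graph *)

Section RandomGraph.
Variables (R : realType) (n k : nat) (M : dcsbm_model R n k).
Hypothesis H_gt0 : forall a, 0 < H_ M a.
Hypothesis n_gt0 : (0 < n)%N.

Local Notation F := (f_norm1 M).
Local Notation p := (edge_prob M).

Definition pairs : {set 'I_n * 'I_n} :=
  [set ij : 'I_n * 'I_n | (ij.1 < ij.2)%N]%SET.

Local Notation conf := {ffun 'I_n * 'I_n -> bool}.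

Lemma sum_pairs (Q : 'I_n -> 'I_n -> R) : (forall i, Q i i = 0) ->
  \sum_i \sum_j Q i j = \sum_(e in pairs) (Q e.1 e.2 + Q e.2 e.1).
Proof.
move=> Q0; rewrite pair_bigA /= big_split /=.
rewrite [X in _ = _ + X](reindex_inj (h := fun e => (e.2, e.1))) /=; last first.
  by move=> [a b] [c e] [-> ->].
rewrite (bigID (mem pairs)) /=; congr (_ + _).
rewrite (bigID (fun e : 'I_n * 'I_n => e.1 == e.2)) /= big1 ?add0r => [|e /andP[_ /eqP ->]] //.
apply: eq_bigl => -[i j]; rewrite !inE /= -leqNgt.
by rewrite ltn_neqAle andbC eq_sym.
Qed.

Definition graph_of (v : conf) : 'M[R]_n :=
  \matrix_(i, j) (if (i < j)%N then v (i, j) else (j < i)%N && v (j, i))%:R.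

Lemma graph_ofC v i j : graph_of v i j = graph_of v j i.
Proof. by rewrite !mxE; case: ltngtP => // /val_inj ->. Qed.

Lemma graph_of_ge0 v i j : 0 <= graph_of v i j.
Proof. by rewrite mxE; exact: ler0n. Qed.

Lemma graph_of_diag v i : graph_of v i i = 0.
Proof. by rewrite mxE ltnn. Qed.

Lemma graph_of_pair v e : e \in pairs -> graph_of v e.1 e.2 = (v e)%:R.
Proof. by rewrite inE mxE => ->; case: e. Qed.

Lemma edge_probC i j : p (i, j) = p (j, i).
Proof.
rewrite /edge_prob /= mulrAC; congr (_ * _ * _).
by rewrite -[in LHS](conn_sym M) mxE.
Qed.

Lemma sum_edge_prob_pairs : 2 * \sum_(e in pairs) p e <= F.
Proof.
rewrite mulr_sumr (f_norm1_sum H_gt0).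
pose Q i j : R := if i == j then 0 else p (i, j).
have -> : \sum_(e in pairs) 2 * p e = \sum_i \sum_j Q i j.
  rewrite sum_pairs => [|i]; last by rewrite /Q eqxx.
  apply: eq_bigr => -[i j]; rewrite inE /Q /= => ij.
  rewrite [j == i]eq_sym; case: eqVneq => [e|_]; first by rewrite e ltnn in ij.
  by rewrite [p (j, i)]edge_probC; ring.
apply: ler_sum => i _; apply: ler_sum => j _; rewrite /Q.
by case: ifP => // _; have /andP[] := edge_prob01 M (i, j).
Qed.

Definition sgn_coef (x y : {ffun 'I_n -> bool}) (e : 'I_n * 'I_n) : R :=
  (-1) ^+ x e.1 * (-1) ^+ y e.2 + (-1) ^+ x e.2 * (-1) ^+ y e.1.

Lemma sgn_coef_le x y e : `|sgn_coef x y e| <= 2.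
Proof.
apply: le_trans (ler_normD _ _) _.
by rewrite !normrM !normrX !normrN1 !expr1n; lra.
Qed.

Lemma noise_form (v : conf) (x y : {ffun 'I_n -> bool}) :
  \sum_i \sum_j noise M (graph_of v) i j * ((-1) ^+ x i * (-1) ^+ y j) =
  \sum_(e in pairs) sgn_coef x y e * ((v e)%:R - p e).
Proof.
rewrite sum_pairs => [|i]; last by rewrite mxE eqxx mul0r.
apply: eq_bigr => e ep; have := graph_of_pair v ep; case: e ep => i j /=.
rewrite inE /= => ij gE; rewrite ![noise _ _ _ _]mxE [j == i]eq_sym.
case: eqVneq => [e|_]; first by rewrite e ltnn in ij.
by rewrite [graph_of v j i]graph_ofC gE [p (j, i)]edge_probC /sgn_coef /=; ring.
Qed.

Definition radius : R := Num.sqrt (n%:R * F) + n%:R.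

(** The configurations for which the deterministic bound applies. *)
Definition regular (v : conf) : bool :=
  (\sum_i \sum_j graph_of v i j <= 100 * F) &&
  [forall x : {ffun 'I_n -> bool}, forall y : {ffun 'I_n -> bool},
    \sum_i \sum_j noise M (graph_of v) i j * ((-1) ^+ x i * (-1) ^+ y j)
      <= 12 * radius].

Lemma f_norm1_gt0 : 0 < F.
Proof.
rewrite (f_norm1E H_gt0) (bigD1 (Ordinal n_gt0)) //= ltr_pwDl ?f_gt0 //.
by apply: sumr_ge0 => i _; rewrite ltW // f_gt0.
Qed.

(** Markov's inequality for the total degree, whose mean is at most [F]. *)
Lemma many_edges :
  \sum_(v in configs pairs) law pairs p v *
    (100 * F < \sum_i \sum_j graph_of v i j)%R%:R <= 100%:R^-1.
Proof.
have F0 := f_norm1_gt0.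
have eE v : \sum_i \sum_j graph_of v i j = \sum_(e in pairs) 2 * (v e)%:R.
  rewrite sum_pairs => [|i]; last exact: graph_of_diag.
  apply: eq_bigr => e ep; rewrite [graph_of v e.2 _]graph_ofC graph_of_pair //.
  by ring.
apply: (@le_trans _ _ (\sum_(v in configs pairs) law pairs p v *
   ((\sum_(e in pairs) 2 * (v e)%:R) / (100 * F)))).
  apply: ler_sum => v _; apply: ler_wpM2l; first exact: law_ge0 (edge_prob01 M) v.
  rewrite eE ler_pdivlMr ?mulr_gt0 //; case: ltP => [/ltW|_]; first by rewrite mul1r.
  by rewrite mul0r; apply: sumr_ge0 => e _; rewrite mulr_ge0.
under eq_bigr do rewrite mulrA mulr_sumr.
rewrite -mulr_suml exchange_big /=.
have -> : \sum_(e in pairs) \sum_(v in configs pairs) law pairs p v * (2 * (v e)%:R)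
    = 2 * \sum_(e in pairs) p e.
  rewrite mulr_sumr; apply: eq_bigr => e ep; rewrite -(law_mean p ep) mulr_sumr.
  by apply: eq_bigr => v _; ring.
rewrite ler_pdivrMr ?mulr_gt0 // mulrA mulVf ?mul1r //.
exact: sum_edge_prob_pairs.
Qed.

(** The Chernoff bound at [s = sqrt n / (sqrt F + 2 * sqrt n)].  This choice keeps
    [s] times each coefficient, which is at most 2, below 1, while
    [s ^ 2 * F <= n] and [12 * s * radius >= 6 * n]; the exponent
    [4 * s ^ 2 * F - 12 * s * radius] is then at most [- 2 * n]. *)
Lemma large_noise (x y : {ffun 'I_n -> bool}) :
  \sum_(v in configs pairs) law pairs p v *
    (12 * radius < \sum_i \sum_j noise M (graph_of v) i j *
       ((-1) ^+ x i * (-1) ^+ y j))%R%:R <= expR (- (2 * n%:R)).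
Proof.
have F0 := f_norm1_gt0; have n0 : 0 < n%:R :> R by rewrite ltr0n.
pose rn : R := Num.sqrt n%:R; pose rF : R := Num.sqrt F.
have rn0 : 0 < rn by rewrite sqrtr_gt0.
have rF0 : 0 < rF by rewrite sqrtr_gt0.
have rn2 : rn ^+ 2 = n%:R by rewrite sqr_sqrtr.
have rF2 : rF ^+ 2 = F by rewrite sqr_sqrtr // ltW.
have radE : radius = rn * rF + rn ^+ 2 by rewrite /radius sqrtrM // rn2.
pose s := rn / (rF + 2 * rn).
have den : 0 < rF + 2 * rn by lra.
have s0 : 0 < s by rewrite divr_gt0.
have s12 : 2 * s <= 1 by rewrite mulrA ler_pdivrMr // mul1r; lra.
have sF : s ^+ 2 * F <= n%:R.
  have : s * rF <= rn by rewrite mulrAC ler_pdivrMr // ler_pM2l //; lra.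
  rewrite -rF2 -rn2 -exprMn => h; rewrite lerXn2r // nnegrE; last exact: ltW.
  by rewrite mulr_ge0 // ltW.
have sr : 6 * n%:R <= s * (12 * radius).
  rewrite radE -rn2 /s.
  have -> : rn / (rF + 2 * rn) * (12 * (rn * rF + rn ^+ 2)) =
    6 * rn ^+ 2 + 6 * rn ^+ 2 * rF / (rF + 2 * rn) by field; rewrite gt_eqF.
  rewrite lerDl divr_ge0 ?(ltW den) // !mulr_ge0 ?sqr_ge0 //; exact: ltW.
have sa e : s * sgn_coef x y e <= 1.
  apply: le_trans (ler_norm _) _; rewrite normrM gtr0_norm //.
  by apply: le_trans s12; rewrite [leRHS]mulrC ler_pM2l // sgn_coef_le.
have ch := law_chernoff pairs (edge_prob01 M) sa.
apply: (@le_trans _ _ (\sum_(v in configs pairs) law pairs p v *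
  expR (s * \sum_(e in pairs) sgn_coef x y e * ((v e)%:R - p e)) *
  expR (- (s * (12 * radius))))).
  apply: ler_sum => v _; rewrite -mulrA; apply: ler_wpM2l.
    exact: law_ge0 (edge_prob01 M) v.
  rewrite noise_form -expRD; case: ltP => h; last exact: expR_ge0.
  by rewrite -[leLHS]expR0 ler_expR subr_ge0 ler_pM2l // ltW.
rewrite -mulr_suml; apply: le_trans (ler_wpM2r (expR_ge0 _) ch) _.
rewrite -expRD ler_expR.
have : \sum_(e in pairs) 2 * (s * sgn_coef x y e) ^+ 2 * p e <=
    8 * s ^+ 2 * \sum_(e in pairs) p e.
  rewrite mulr_sumr; apply: ler_sum => e _; apply: ler_wpM2r.
    by have /andP[] := edge_prob01 M e.
  have a2 : sgn_coef x y e ^+ 2 <= 4.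
    have := sgn_coef_le x y e; rewrite -(real_normK (num_real (sgn_coef x y e))).
    by have := normr_ge0 (sgn_coef x y e); nra.
  rewrite exprMn; have := ler_wpM2l (sqr_ge0 s) a2; lra.
have := ler_wpM2l (sqr_ge0 s) sum_edge_prob_pairs.
lra.
Qed.

(** Union bound over the [4 ^ n] pairs of sign vectors, with
    [4 ^ n * exp (- 2 * n) = (exp 1 / 2) ^- (2 * n)]. *)
Lemma irregular_law :
  \sum_(v in configs pairs | ~~ regular v) law pairs p v <=
  100%:R^-1 + (expR 1 / 2) ^- (2 * n).
Proof.
pose ev v : R := (100 * F < \sum_i \sum_j graph_of v i j)%R%:R.
pose nv (xy : {ffun 'I_n -> bool} * {ffun 'I_n -> bool}) v : R :=
  (12 * radius < \sum_i \sum_j noise M (graph_of v) i j *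
       ((-1) ^+ xy.1 i * (-1) ^+ xy.2 j))%R%:R.
apply: (@le_trans _ _ (\sum_(v in configs pairs) law pairs p v * ev v +
  \sum_xy \sum_(v in configs pairs) law pairs p v * nv xy v)).
  rewrite [X in _ <= _ + X]exchange_big -big_split big_mkcondr; apply: ler_sum => v _ /=.
  rewrite -mulr_sumr -mulrDr.
  have l0 : 0 <= law pairs p v by exact: law_ge0 (edge_prob01 M) v.
  have e0 : 0 <= ev v by [].
  have s0 (P : pred _) : 0 <= \sum_(xy | P xy) nv xy v by exact: sumr_ge0.
  case: ifP => [|_]; last by rewrite mulr_ge0 // addr_ge0 // s0.
  rewrite negb_and -ltNge => h; rewrite ler_peMr //; case/orP: h => h.
    by rewrite /ev h lerDl s0.
  have [x hx] := forallPn h; have [y hy] := forallPn hx.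
  rewrite -ltNge in hy; rewrite (bigD1 (x, y)) //= {1}/nv /= hy.
  by rewrite addrCA lerDl addr_ge0 // s0.
apply: lerD; first exact: many_edges.
apply: (@le_trans _ _ (\sum_(xy : {ffun 'I_n -> bool} * {ffun 'I_n -> bool})
   expR (- (2 * n%:R)))).
  by apply: ler_sum => xy _; exact: large_noise.
rewrite sumr_const card_prod !card_ffun card_bool card_ord -[leLHS]mulr_natl.
rewrite -expnD addnn -mul2n expRN -natrM expr_div_n invf_div natrX.
by rewrite -[(2 * n)%:R]mulr1 expRM_natl.
Qed.

(** The property [Q] depends on finitely many random bits, so the event that it
    holds is measurable whatever [Q] is. *)
Theorem prob_regular d (T : measurableType d) (P : probability T R)
    (A : 'I_n -> 'I_n -> {RV P >-> bool}) (Q : 'M[R]_n -> Prop) :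
  is_dcsbm M A -> (forall v, regular v -> Q (graph_of v)) ->
  ((99%:R / 100%:R - 2 * (expR 1 / 2) ^- (2 * n))%:E <=
    P [set w | Q (adj A w)]%classic)%E.
Proof.
move=> [Asym Airr Aprob Aindep] hQ.
pose X (e : 'I_n * 'I_n) := A e.1 e.2.
have adjE w : adj A w = graph_of (config pairs X w).
  apply/matrixP => i j; rewrite !mxE !ffunE !inE /= /X /=.
  case: ltngtP => [//|//=|/val_inj ->]; last by rewrite Airr.
  by rewrite Asym.
have Xprob e : e \in pairs -> P [set w | X e w = true]%classic = (p e)%:E.
  rewrite inE => h; apply: Aprob; apply: contraTneq h => ->.
  by rewrite ltnn.
have bad_le := prob_config_le Aindep Xprob (fun v => ~~ regular v).
have mreg := measurable_config pairs X (fun v => regular v).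
have mbad := measurable_config pairs X (fun v => ~~ regular v).
(* The event of the statement is a union of atoms of the finite configuration. *)
have mQ : measurable [set w | Q (adj A w)]%classic.
  have -> : [set w | Q (adj A w)]%classic =
    [set w | (fun v => `[< Q (graph_of v) >]) (config pairs X w)]%classic.
    by apply/seteqP; split => w /=; rewrite adjE => /asboolP.
  exact: (measurable_config pairs X (fun v => `[< Q (graph_of v) >])).
apply: (@le_trans _ _ (P [set w | regular (config pairs X w)]%classic)); last first.
  apply: le_measure; rewrite ?inE // => w /= h; rewrite adjE; exact: hQ.
have -> : [set w | regular (config pairs X w)]%classic =
   (~` [set w | ~~ regular (config pairs X w)])%classic.
  by apply/seteqP; split => w /=; [move=> ->|move/negP; rewrite negbK].
rewrite probability_setC //.
have q0 : 0 <= (expR 1 / 2) ^- (2 * n) :> R.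
  by rewrite invr_ge0 exprn_ge0 // divr_ge0 // expR_ge0.
have h : (P [set w | ~~ regular (config pairs X w)]%classic <=
    (100%:R^-1 + (expR 1 / 2) ^- (2 * n))%:E)%E.
  by apply: le_trans bad_le _; rewrite lee_fin; exact: irregular_law.
apply: (@le_trans _ _ (1 - (100%:R^-1 + (expR 1 / 2) ^- (2 * n))%:E)%E).
  rewrite -EFinB lee_fin; lra.
exact: leeB.
Qed.

End RandomGraph.

(** * Gap conditions on the tuning parameter *)

Section TuningParameter.
Variables (R : realType) (n k : nat) (M : dcsbm_model R n k).
Variables (lambda delta : R).
Hypothesis k_gt1 : (1 < k)%N.
Hypothesis H_gt0 : forall a, 0 < H_ M a.
Hypothesis delta_gt0 : 0 < delta.
Hypothesis lambda_gt : max_offdiag M delta < lambda.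
Hypothesis lambda_lt : lambda < min_diag M delta.

Lemma sup_ge_fin (I : finType) (D : set I) (f : I -> R) (i : I) :
  D i -> f i <= sup (f @` D)%classic.
Proof.
move=> Di; apply: ub_le_sup; last by exists i.
exists (\sum_j `|f j|) => _ [j _ <-]; rewrite (bigD1 j) //=.
by apply: le_trans (ler_norm _) _; rewrite lerDl sumr_ge0.
Qed.

Lemma lambda_offdiag (a b : 'I_k) : a != b ->
  conn M a b + delta <= lambda * (H_ M a * H_ M b).
Proof.
have lt_case (c e : 'I_k) : (c < e)%N ->
    conn M c e + delta <= lambda * (H_ M c * H_ M e).
  move=> ce; rewrite -ler_pdivrMr ?mulr_gt0 //; apply: ltW; apply: le_lt_trans lambda_gt.
  exact: (@sup_ge_fin _ [set ab : 'I_k * 'I_k | (ab.1 < ab.2)%N]%classic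
    (fun ab => (conn M ab.1 ab.2 + delta) / (H_ M ab.1 * H_ M ab.2)) (c, e)).
move=> ab; case: (ltngtP a b) => [|ba|/val_inj e]; first exact: lt_case.
  by rewrite -(conn_sym M) mxE [H_ M a * _]mulrC lt_case.
by rewrite e eqxx in ab.
Qed.

Lemma lambda_diag (a : 'I_k) : lambda * H_ M a ^+ 2 + delta <= conn M a a.
Proof.
rewrite -lerBrDr -ler_pdivlMr ?exprn_gt0 //; apply: ltW; apply: lt_le_trans lambda_lt _.
apply: ge_inf; last by exists a.
exists (- \sum_b `|(conn M b b - delta) / H_ M b ^+ 2|) => _ [b _ <-].
rewrite (bigD1 b) //= lerNl; apply: le_trans (ler_norm _) _.
by rewrite normrN lerDl sumr_ge0.
Qed.

(** Two communities give one off-diagonal gap, whose left side is positive. *)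
Lemma lambda_gt0 : 0 < lambda.
Proof.
pose a : 'I_k := Ordinal (ltnW k_gt1); pose b : 'I_k := Ordinal k_gt1.
have ab : a != b by [].
have /andP[c0 _] := conn01 M a b.
rewrite -(pmulr_lgt0 _ (mulr_gt0 (H_gt0 a) (H_gt0 b))).
by apply: lt_le_trans (lambda_offdiag ab); rewrite ltr_wpDl.
Qed.

Lemma lambda_f_le : lambda * f_norm1 M <= max_diag_f M.
Proof.
pose a : 'I_k := Ordinal (ltnW k_gt1).
have F0 : 0 <= f_norm1 M by exact: sumr_ge0.
apply: (@le_trans _ _ (conn M a a / H_ M a ^+ 2 * f_norm1 M)).
  rewrite ler_wpM2r // ler_pdivlMr ?exprn_gt0 //.
  by apply: le_trans (lambda_diag a); rewrite lerDl ltW.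
exact: (@sup_ge_fin _ setT (fun b => conn M b b / H_ M b ^+ 2 * f_norm1 M) a).
Qed.

End TuningParameter.

Local Open Scope classical_set_scope.

Theorem theorem4p5 (R : realType) :
  exists C0 : R, 0 < C0 /\
  forall (d : measure_display) (T : measurableType d) (P : probability T R)
    (n k : nat) (M : dcsbm_model R n k) (A : 'I_n -> 'I_n -> {RV P >-> bool})
    (p : nat) (lambda : R),
  (2 <= k)%N -> (forall a, 0 < H_ M a) -> is_dcsbm M A -> (1 <= p <= k)%N ->
  (forall (w : T) (U : 'M[R]_(n, k)), relax_opt p lambda (adj A w) U ->
   forall (alpha : nat -> R) (Phi : 'M[R]_(n, k)) (X : 'M[R]_k),
   0 <= alpha k -> kmeans_approx (alpha k) U Phi X ->
   (min_err M Phi)%:R <=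
     8 * Num.sqrt k%:R * (n_max M)%:R / (theta_min M * (n_min M)%:R)
     * (1 + (n_max M)%:R / (n_min M)%:R) * (1 + alpha k)
     * Num.sqrt (norm1theta M (U *m U^T - Phi_star M *m (Phi_star M)^T)))
  /\
  (forall delta : R, density_gap M -> 0 < delta ->
   max_offdiag M delta < lambda -> lambda < min_diag M delta ->
   ((99%:R / 100%:R - 2 * (expR 1 / 2) ^- (2 * n))%:E <=
    P [set w | forall U : 'M[R]_(n, k), relax_opt p lambda (adj A w) U ->
       (norm1theta M (U *m U^T - Phi_star M *m (Phi_star M)^T) <=
         C0 / delta * (1 + max_diag_f M)
         * (Num.sqrt (n%:R * f_norm1 M) + n%:R))%R])%E).
Proof.
(* [196 * 12] from the noise and [101 * (12 + 1)] from the degrees: both are at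
   most 2400. *)
exists (24 * 100); split; first by rewrite mulr_gt0.
move=> d T P n k M A p lambda k2 H0 HA /andP[p0 _].
split=> [w U [[Uu _ Up] _] alpha Phi X a0 hk|delta _ d0 l1 l2].
  by have := min_err_bound M (ltnW k2) Uu Up a0 hk; rewrite /gram_gap.
have n0 : (0 < n)%N.
  by have [i _] := label_surj M (Ordinal (ltnW k2)); apply: leq_ltn_trans (ltn_ord i).
apply: (prob_regular H0 n0 (Q := fun G => forall U, relax_opt p lambda G U -> _) HA).
move=> v /andP[vtot /forallP vnoise] U hU.
have noise_v : sign_bound (noise M (graph_of R v)) (12 * radius M).
  by move=> x y; have /forallP := vnoise x; exact.
have l0 := ltW (lambda_gt0 k2 H0 d0 l1).
have := gap_bound H0 p0 (graph_of_ge0 R v) (graph_of_diag R v) noise_v vtot l0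
  (lambda_diag H0 l2) (lambda_offdiag H0 l1) hU.
rewrite -/(gram_gap M U) -/(radius M) => h.
rewrite [leRHS](_ : _ = (24 * 100 * (1 + max_diag_f M) * radius M) / delta); last first.
  by ring.
rewrite ler_pdivlMr // mulrC; apply: le_trans h _.
have lF := lambda_f_le k2 H0 d0 l2.
have lF0 : 0 <= lambda * f_norm1 M by rewrite mulr_ge0 // sumr_ge0.
have rn : n%:R <= radius M by rewrite /radius lerDr sqrtr_ge0.
have r0 : 0 <= radius M by apply: le_trans rn.
have h1 := ler_wpM2l lF0 rn.
have h2 := ler_wpM2r r0 lF.
have h3 := mulr_ge0 lF0 r0.
lra.
Qed.
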